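(* Let $(P_n)$ be a sequence of finite unlabelled posets with $|P_n|\to\infty$. Then the following are equivalent: (i) $P_n\to\Pi$ in $\overline{\mathcal P}$ for some $\Pi\in\overline{\mathcal P}$; (ii) $\widehat P_n\to R$ in distribution in $\mathcal P^L_{\mathbb N}$ for some random $R\in\mathcal P^L_{\mathbb N}$. If these hold, then $R$ is exchangeable and $R\overset{d}{=}P(\infty,\Pi)$; consequently $t(Q,\Pi)=\mathbb P(R\supseteq Q)$ and $t_{\mathrm{ind}}(Q,\Pi)=\mathbb P(R|_A=Q)$ for every finite labelled poset $Q$ with ground set $A\subset\mathbb N$.
   Context: A poset is a nonempty set with a strict partial order $<$. For finite posets $Q,P$: $t(Q,P)$ is the proportion of all maps $\varphi$ from the ground set of $Q$ to that of $P$ with $x<_Qy\Rightarrow\varphi(x)<_P\varphi(y)$; $t_{\mathrm{ind}}(Q,P)$ is the proportion of injective maps with $x<_Qy\iff\varphi(x)<_P\varphi(y)$ ($0$ if $|Q|>|P|$). Let $\mathcal P$ be the set of isomorphism classes of finite nonempty posets; identify $\mathcal P$ with its (injective) image under $P\mapsto((t(Q,P))_{Q\in\mathcal P},|P|^{-1})\in[0,1]^{\mathcal P}\times[0,1]$, let $\overline{\mathcal P}$ be the closure (product topology) and $\mathcal P_\infty=\overline{\mathcal P}\setminus\mathcal P$; $t(Q,\cdot),t_{\mathrm{ind}}(Q,\cdot)$ extend continuously to $\overline{\mathcal P}$. $\mathcal P^L_{\mathbb N}$ is the set of posets on $\mathbb N$, a compact metrizable subset of $\{0,1\}^{\mathbb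 N\times\mathbb N}$ (product topology) via indicators $\mathbf 1\{i<j\}$. For a finite unlabelled poset $P$, $\widehat P$ is the random labelled poset obtained by labelling $P$ by $1,\dots,|P|$ uniformly at random (each of the $|P|!$ labellings equally likely), extended to a poset on $\mathbb N$ by adding the points $|P|+1,|P|+2,\dots$ incomparable to everything. A random poset on $\mathbb N$ is exchangeable if its law is invariant under permutations of $\mathbb N$. For a labelled poset $Q$ with ground set $A\subset\mathbb N$, $R\supseteq Q$ means $x<_Qy\Rightarrow x<_Ry$; $R|_A$ is $A$ with the order induced by $R$. An ordered probability space $(\mathcal S,\mathcal F,\mu,\prec)$ is a probability space with a strict partial order $\prec$ with $\{(x,y):x\prec y\}\in\mathcal F\times\mathcal F$; a kernel on it is a measurable $W:\mathcal S^2\to[0,1]$ with $W(x,y)>0\Rightarrow x\prec y$ and ($W(x,y)>0$, $W(y,z)>0$) $\Rightarrow W(x,z)=1$ for all $x,y,z$; $\Pi_W\in\mathcal P_\infty$ satisfies $t(Q,\Pi_W)=\int\prod_{(i,j):i<_Qj}W(x_i,x_j)\,d\mu(x_1)\cdots d\mu(x_{|Q|})$ for all $Q$. $P(\infty,W)$ is the random poset on $\mathbb N$ obtained from i.i.d. $X_i\sim\mu$ and independent i.i.d. $\xi_{ij}\sim U(0,1)$ with $i\prec j$ iff $\xi_{ij}<W(X_i,X_j)$. Every $\Pi\in\mathcal P_\infty$ equals $\Pi_W$ for some kernel, the law of $P(\infty,W)$ depends only on $\Pi_W$, and $P(\infty,\Pi)$ denotes $P(\infty,W)$ for any $W$ with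 $\Pi_W=\Pi$. *)

(* Defs.v *)
From HB Require Import structures.
From mathcomp Require Import all_boot all_order all_algebra fingroup perm.
From mathcomp Require Import all_classical all_reals all_analysis.
Set Implicit Arguments. Unset Strict Implicit. Unset Printing Implicit Defensive.
Import Order.TTheory GRing.Theory Num.Theory.
Import numFieldNormedType.Exports.
Local Open Scope classical_set_scope.
Local Open Scope ring_scope.

From Stdlib Require List.
Record fposet := FPoset { fp_n : nat; fp_rel : rel 'I_fp_n }.
Arguments fp_rel : clear implicits.

Definition is_fposet (P : fposet) : Prop :=
  (0 < fp_n P)%N /\ irreflexive (fp_rel P) /\ transitive (fp_rel P).

Section Densities.
Variable R : realType.

Definition tdens (Q P : fposet) : R :=
  (#|[set phi : {ffun 'I_(fp_n Q) -> 'I_(fp_n P)} |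
      [forall x, forall y, fp_rel Q x y ==> fp_rel P (phi x) (phi y)]]|)%:R
  / ((fp_n P) ^ (fp_n Q))%:R.

Definition tind (Q P : fposet) : R :=
  if (fp_n P < fp_n Q)%N then 0 else
  (#|[set phi : {ffun 'I_(fp_n Q) -> 'I_(fp_n P)} | injectiveb phi &&
      [forall x, forall y, fp_rel Q x y == fp_rel P (phi x) (phi y)]]|)%:R
  / (#|[set phi : {ffun 'I_(fp_n Q) -> 'I_(fp_n P)} | injectiveb phi]|)%:R.

(* A point of [0,1]^{posets} x [0,1]: coordinates t(Q,.) and |P|^-1 *)
Definition ppoint := ((fposet -> R) * R)%type.

Definition embed (P : fposet) : ppoint :=
  (fun Q => tdens Q P, (fp_n P)%:R^-1).

(* convergence of finite posets to a point, in the product topology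
   (i.e. coordinatewise) *)
Definition fp_cvg (u : nat -> fposet) (Pi : ppoint) : Prop :=
  (forall Q, is_fposet Q -> (fun n => tdens Q (u n)) @ \oo --> Pi.1 Q) /\
  ((fun n => (fp_n (u n))%:R^-1 : R) @ \oo --> Pi.2).

(* membership in the closure \overline{P} (product topology): every basic
   neighbourhood (finitely many coordinates, radius eps) meets the image *)
Definition in_closure (Pi : ppoint) : Prop :=
  forall (Qs : seq fposet) (eps : R), 0 < eps ->
    (forall Q, List.In Q Qs -> is_fposet Q) ->
    exists P, is_fposet P /\
      (forall Q, List.In Q Qs -> `|tdens Q P - Pi.1 Q| < eps) /\
      `|(fp_n P)%:R^-1 - Pi.2| < eps.

(* c is the value at Pi of the continuous extension of t_ind(Q,.) *)
Definition tind_ext (Q : fposet) (Pi : ppoint) (c : R) : Prop :=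
  forall u : nat -> fposet, (forall n, is_fposet (u n)) -> fp_cvg u Pi ->
    (fun n => tind Q (u n)) @ \oo --> c.

End Densities.

(* relations on nat (indicator of i < j), an element of {0,1}^{N x N} *)
Definition cube := (nat * nat -> bool)%type.

Definition is_Nposet (x : cube) : Prop :=
  (forall i, ~~ x (i, i)) /\
  (forall i j k, x (i, j) -> x (j, k) -> x (i, k)).

(* the labelling of P given by the permutation s (point p gets label
   s^-1 p, labels 0..|P|-1), extended by incomparable points *)
Definition hat_rel (P : fposet) (s : {perm 'I_(fp_n P)}) : cube :=
  fun ij =>
    match insub ij.1, insub ij.2 with
    | Some i, Some j => fp_rel P (s i) (s j)
    | _, _ => false
    end.

(* product (= Borel) sigma-algebra of {0,1}^{N x N} *)
Definition cube_measurable (B : set cube) : Prop :=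
  <<s [set C : set cube | exists ij, C = [set x | x ij]] >> B.

Section Random.
Variable R : realType.
Local Open Scope ereal_scope.

Definition random_Nposet d (Omega : measurableType d)
    (X : Omega -> cube) : Prop :=
  (forall w, is_Nposet (X w)) /\
  (forall ij, measurable [set w | X w ij]).

Definition same_law d1 (O1 : measurableType d1) (P1 : probability O1 R)
    (X1 : O1 -> cube) d2 (O2 : measurableType d2) (P2 : probability O2 R)
    (X2 : O2 -> cube) : Prop :=
  forall B, cube_measurable B -> P1 (X1 @^-1` B) = P2 (X2 @^-1` B).

Definition hat_expect (P : fposet) (f : cube -> R) : R :=
  ((\sum_(s : {perm 'I_(fp_n P)}) f (hat_rel s)) / (fp_n P)`!%:R)%R.

Definition cvg_dist (u : nat -> fposet) d (Omega : measurableType d)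
    (Pr : probability Omega R) (X : Omega -> cube) : Prop :=
  forall f : {ptws (nat * nat) -> bool} -> R,
    continuous f -> (exists M : R, forall x, (`|f x| <= M)%R) ->
    (fun n => (hat_expect (u n) f)%:E) @ \oo --> \int[Pr]_w (f (X w))%:E.

Definition exchangeable d (Omega : measurableType d)
    (Pr : probability Omega R) (X : Omega -> cube) : Prop :=
  forall pi : nat -> nat, bijective pi ->
    same_law Pr (fun w => fun ij => X w (pi ij.1, pi ij.2)) Pr X.

Definition ordered_prob d (S : measurableType d) (prec : S -> S -> Prop) : Prop :=
  (forall x, ~ prec x x) /\
  (forall x y z, prec x y -> prec y z -> prec x z) /\
  measurable [set p : S * S | prec p.1 p.2].

Definition is_kernel d (S : measurableType d) (prec : S -> S -> Prop)
    (W : S -> S -> R) : Prop :=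
  measurable_fun setT (fun p : S * S => W p.1 p.2) /\
  (forall x y, (0 <= W x y <= 1)%R) /\
  (forall x y, (0 < W x y)%R -> prec x y) /\
  (forall x y z, (0 < W x y)%R -> (0 < W y z)%R -> W x z = 1%R).

Fixpoint iter_int d (S : measurableType d) (mu : probability S R) (n : nat)
    (f : (nat -> S) -> \bar R) : \bar R :=
  match n with
  | 0 => f (fun _ => point)
  | k.+1 => \int[mu]_y iter_int mu k
              (fun x => f (fun i => if i == k then y else x i))
  end.

Definition is_PiW d (S : measurableType d) (mu : probability S R)
    (W : S -> S -> R) (Pi : ppoint R) : Prop :=
  (forall Q, is_fposet Q ->
     (Pi.1 Q)%:E = iter_int mu (fp_n Q) (fun x =>
       (\prod_(i : 'I_(fp_n Q)) \prod_(j : 'I_(fp_n Q) | fp_rel Q i j)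
          W (x i) (x j))%:E)) /\
  Pi.2 = 0%R.

(* (Omega, Pr, X, xi) realizes the construction of P(infty, W):
   X_i i.i.d. ~ mu, xi_ij i.i.d. ~ U(0,1), all mutually independent *)
Definition pinf_sample d (S : measurableType d) (mu : probability S R)
    dO (Omega : measurableType dO) (Pr : probability Omega R)
    (X : nat -> Omega -> S) (xi : nat * nat -> Omega -> R) : Prop :=
  (forall i, measurable_fun setT (X i)) /\
  (forall ij, measurable_fun setT (xi ij)) /\
  forall (F : seq nat) (G : seq (nat * nat)) (A : nat -> set S)
         (B : nat * nat -> set R),
    uniq F -> uniq G -> (forall i, measurable (A i)) ->
    (forall ij, measurable (B ij)) ->
    Pr ((\bigcap_(i in [set i | i \in F]) (X i @^-1` A i)) `&`
        (\bigcap_(k in [set k | k \in G]) (xi k @^-1` B k))) =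
    (\prod_(i <- F) mu (A i)) *
    (\prod_(k <- G) lebesgue_measure (B k `&` `[0%R, 1%R]%classic)).

Definition pinf_poset d (S : measurableType d) (W : S -> S -> R)
    dO (Omega : measurableType dO)
    (X : nat -> Omega -> S) (xi : nat * nat -> Omega -> R) : Omega -> cube :=
  fun w ij => (xi ij w < W (X ij.1 w) (X ij.2 w))%R.

Definition law_Pinf dO (Omega : measurableType dO) (Pr : probability Omega R)
    (Y : Omega -> cube) (Pi : ppoint R) : Prop :=
  forall d (S : measurableType d) (mu : probability S R)
    (prec : S -> S -> Prop) (W : S -> S -> R),
    ordered_prob prec -> is_kernel prec W -> is_PiW mu W Pi ->
    forall d' (O' : measurableType d') (P' : probability O' R)
      (X : nat -> O' -> S) (xi : nat * nat -> O' -> R),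
      pinf_sample mu P' X xi ->
      same_law Pr Y P' (pinf_poset W X xi).

End Random.

Definition is_lposet (A : seq nat) (q : rel nat) : Prop :=
  uniq A /\ A != [::] /\
  (forall x, x \in A -> ~~ q x x) /\
  (forall x y z, x \in A -> y \in A -> z \in A -> q x y -> q y z -> q x z).

(* its isomorphism class, as a code on 'I_|A| *)
Definition lposet_code (A : seq nat) (q : rel nat) : fposet :=
  @FPoset (size A) (fun i j => q (nth 0 A i) (nth 0 A j)).

(* Main.v *)
Require Import Defs.
From HB Require Import structures.
From mathcomp Require Import all_boot all_order all_algebra fingroup perm.
From mathcomp Require Import all_classical all_reals all_analysis.
From mathcomp Require Import measurable_realfun lra.
Set Implicit Arguments.
Unset Strict Implicit.
Unset Printing Implicit Defensive.
Import Order.TTheory GRing.Theory Num.Theory.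
Import numFieldNormedType.Exports.
Local Open Scope classical_set_scope.
Local Open Scope ring_scope.

(** A uniform random labelling restricted to finitely many labels is a uniform
    injection, so the probability that the random labelled poset contains a
    finite poset [Q] on given labels is the injective homomorphism density of
    [Q], which differs from [t(Q, P)] by at most the proportion of non-injective
    maps; this tends to [0] as [|P|] grows. A finite relation [S] is contained in
    a poset iff its transitive closure is, so convergence of all [t(Q, P_n)] is
    convergence of the probabilities of containing any finite [S], and hence of
    the expectations of all functions of finitely many coordinates. These events
    form a pi-system generating the sigma-algebra: they determine the law of the
    limit, which gives exchangeability (the limits do not depend on the labels)
    and the identification with [P(oo, W)], where Fubini turns the independence
    of the [X_i] and [xi_ij] into [P(S contained) = \int \prod W].

    Conversely, given the limits, a random relation with the limiting cylinder
    probabilities is built on [[0, 1]] with Lebesgue measure from nested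
    intervals indexed by finite words; it is almost surely a poset, and by
    compactness of [{0,1}^(N x N)] continuous functions are uniform limits of
    functions of finitely many coordinates, which yields convergence in
    distribution. *)

(** * Random labellings and injective densities *)

(** List [T] twice, once with the image of [a] first and once with the image of [b] first, each
    followed by the remaining points. Sending each entry of the first list to the entry at the same
    position in the second is the permutation. *)
Lemma perm_extending (aT T : finType) (a b : aT -> T) :
  injective a -> injective b -> exists t : {perm T}, forall i, t (a i) = b i.
Proof.
move=> ia ib.
pose full (c : aT -> T) := codom c ++ enum [predC codom c].
have full_uniq c : injective c -> uniq (full c).
  move=> ic; rewrite cat_uniq enum_uniq andbT; apply/andP; split.
    by rewrite map_inj_uniq ?enum_uniq.
  by apply/hasPn => x /=; rewrite mem_enum.
have full_mem c x : x \in full c.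
  by rewrite mem_cat mem_enum inE orbN.
have full_size c : injective c -> size (full c) = #|T|.
  move=> ic; rewrite -(card_uniqP (full_uniq _ ic)); apply: eq_card => x.
  by rewrite full_mem.
pose f x := nth x (full b) (index x (full a)).
have lt_index x : (index x (full a) < size (full b))%N.
  by rewrite full_size// -(full_size _ ia) index_mem.
have fi : injective f.
  move=> x y; rewrite /f (set_nth_default y x) ?lt_index// => /eqP.
  rewrite nth_uniq ?full_uniq// ?lt_index// => /eqP e.
  by rewrite -(nth_index x (full_mem a x)) e nth_index.
exists (perm fi) => i; rewrite permE /f /full index_cat codom_f /codom.
rewrite index_map// nth_cat size_map index_mem mem_enum.
by rewrite (nth_map i) ?index_mem ?mem_enum// nth_index ?mem_enum.
Qed.

(** The densities count classical sets, whose membership is a decided proposition; this passes to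
    boolean predicates, where finite counting applies. *)
Lemma card_mkset (T : finType) (b : pred T) : #|[set x | b x]| = #|b|.
Proof. by apply: eq_card => x; rewrite -[LHS]/(`[< b x >]) asboolb. Qed.

Lemma card_mksetE (T : finType) (b : pred T) :
  #|[set x | b x]| = #|[set x | b x]%SET|.
Proof. by rewrite card_mkset cardsE. Qed.

(** Restriction of permutations along [a] has fibres of equal size over all injections: if [t]
    carries [a] to [phi], right multiplication by [t] maps the fibre over [a] onto the fibre over
    [phi]. The equality of proportions is stated without division. *)
Lemma card_perm_restr (aT T : finType) (a : aT -> T)
    (D : pred {ffun aT -> T}) : injective a ->
  (#|[set s : {perm T} | D [ffun i => s (a i)]]%SET| *
     #|[set phi : {ffun aT -> T} | injectiveb phi]%SET| =
   #|[set phi : {ffun aT -> T} | injectiveb phi && D phi]%SET| * (#|T|)`!)%N.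
Proof.
move=> ia.
pose res (s : {perm T}) : {ffun aT -> T} := [ffun i => s (a i)].
have res_inj s : injectiveb (res s).
  by apply/injectiveP => i j; rewrite !ffunE => /perm_inj/ia.
pose c := #|[set s | res s == [ffun i => a i]]%SET|.
have fibre (phi : {ffun aT -> T}) : injectiveb phi ->
    #|[set s | res s == phi]%SET| = c.
  move=> /injectiveP ip; have [t tE] := perm_extending ia ip.
  rewrite -[c](card_imset _ (@mulIg _ t)); apply: eq_card => s.
  apply/idP/imsetP => [|[r]].
    rewrite inE => /eqP sE; exists (s * t^-1)%g; last by rewrite mulgKV.
    rewrite inE; apply/eqP/ffunP => i; rewrite !ffunE permM.
    by rewrite -[s (a i)](ffunE (fun i => s (a i))) -/(res s) sE -tE permK.
  rewrite inE => /eqP rE ->; rewrite inE; apply/eqP/ffunP => i.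
  rewrite ffunE permM -[r (a i)](ffunE (fun i => r (a i))) -/(res r) rE ffunE.
  exact: tE.
have count (E : pred {ffun aT -> T}) : #|[set s | E (res s)]%SET| =
    (#|[set phi : {ffun aT -> T} | injectiveb phi && E phi]%SET| * c)%N.
  pose iE (f : {ffun aT -> T}) := injectiveb f && E f.
  rewrite -!sum1_card (partition_big res iE) /=.
    rewrite big_distrl /= [RHS](eq_bigl iE).
      apply: eq_bigr => phi /andP[ip Ep]; rewrite mul1n -(fibre _ ip).
      rewrite -sum1_card; apply: eq_bigl => s; rewrite !inE.
      by case: eqP => [->|]; rewrite ?Ep// andbF.
    by move=> f; rewrite inE.
  by move=> s; rewrite inE /iE res_inj.
(* The same count with the trivial condition expresses the factorial through the common fibre size
   [c]. *)
have -> : (#|T|)`! = #|[set s : {perm T} | predT (res s)]%SET|.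
  rewrite -cardsT -card_perm; apply: eq_card => s; rewrite [RHS]inE.
  by apply/fintype.subsetP => x _; rewrite inE.
rewrite !count mulnAC -mulnA; congr (_ * (_ * _))%N.
by apply: eq_card => f; rewrite !inE andbT.
Qed.

Section labelling.
Variables (R : realType) (P : fposet) (A : seq nat).
Hypothesis uA : uniq A.
Hypothesis ltA : forall x, x \in A -> (x < fp_n P)%N.

Let a (i : 'I_(size A)) : 'I_(fp_n P) :=
  Ordinal (ltA (mem_nth 0 (ltn_ord i))).

Let inj_a : injective a.
Proof.
move=> i j /(congr1 val)/= /eqP; rewrite nth_uniq// => /eqP ij.
exact: val_inj.
Qed.

Lemma hat_rel_label (s : {perm 'I_(fp_n P)}) (i j : 'I_(size A)) :
  hat_rel s (nth 0 A i, nth 0 A j) = fp_rel P (s (a i)) (s (a j)).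
Proof.
have lab (k : 'I_(size A)) : insub (nth 0 A k) = Some (a k).
  rewrite (insubT (fun x => x < fp_n P)%N (ltA (mem_nth 0 (ltn_ord k)))).
  by congr Some; exact: val_inj.
by rewrite /hat_rel /= !lab.
Qed.

Lemma size_labels : (size A <= fp_n P)%N.
Proof. by have := leq_card _ inj_a; rewrite !card_ord. Qed.

(** An event about the labels in [A] sees the random labelling only through its restriction to [A],
    which is a uniform injection. *)
Lemma hat_expect_restr (g : cube -> R)
    (D : pred {ffun 'I_(size A) -> 'I_(fp_n P)}) :
  (forall s : {perm 'I_(fp_n P)},
     g (hat_rel s) = (D [ffun i => s (a i)])%:R) ->
  hat_expect P g =
    #|[set phi : {ffun 'I_(size A) -> 'I_(fp_n P)} | injectiveb phi && D phi]|%:R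
    / #|[set phi : {ffun 'I_(size A) -> 'I_(fp_n P)} | injectiveb phi]|%:R.
Proof.
move=> gE; rewrite !card_mksetE; rewrite /hat_expect (eq_bigr _ (fun s _ => gE s)).
rewrite -natr_sum.
have -> : (\sum_(s : {perm 'I_(fp_n P)}) D [ffun i => s (a i)])%N =
    #|[set s : {perm 'I_(fp_n P)} | D [ffun i => s (a i)]]%SET|.
  by rewrite -sum1dep_card [RHS]big_mkcond.
have inj0 : #|[set phi : {ffun 'I_(size A) -> 'I_(fp_n P)} | injectiveb phi]%SET|%:R
    != 0 :> R.
  by rewrite pnatr_eq0 -lt0n card_inj_ffuns !card_ord ffact_gt0 size_labels.
have fact0 : (fp_n P)`!%:R != 0 :> R by rewrite pnatr_eq0 -lt0n fact_gt0.
apply/eqP; rewrite eqr_div// -!natrM; apply/eqP; congr _%:R.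
by rewrite (card_perm_restr _ inj_a) card_ord.
Qed.

End labelling.

(** A relation on a finite ground set becomes a list of pairs, so that containing it is the boolean
    event [all x (ledges A q)] on finitely many coordinates. *)
Definition ledges (A : seq nat) (q : rel nat) : seq (nat * nat) :=
  [seq e <- [seq (x, y) | x <- A, y <- A] | q e.1 e.2].

Lemma mem_ledges A q x y :
  ((x, y) \in ledges A q) = [&& x \in A, y \in A & q x y].
Proof.
rewrite mem_filter /= andbC andbA; congr (_ && _).
apply/allpairsP/andP => [[[u v] /= [uA vA [-> ->]]]|[xA yA]]; first by [].
by exists (x, y).
Qed.

Section densities.
Variable R : realType.

Definition tinj (Q P : fposet) : R :=
  #|[set phi : {ffun 'I_(fp_n Q) -> 'I_(fp_n P)} | injectiveb phi &&
      [forall x, forall y, fp_rel Q x y ==> fp_rel P (phi x) (phi y)]]|%:R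
  / #|[set phi : {ffun 'I_(fp_n Q) -> 'I_(fp_n P)} | injectiveb phi]|%:R.

Lemma hat_expect_hom (P : fposet) (A : seq nat) (q : rel nat) :
  uniq A -> (forall x, x \in A -> (x < fp_n P)%N) ->
  hat_expect P (fun x => (all x (ledges A q))%:R) = tinj (lposet_code A q) P.
Proof.
move=> uA ltA; apply: (@hat_expect_restr R P A uA ltA) => s; congr _%:R.
congr nat_of_bool; apply/allP/forallP => /= [H i|H [x y]].
  apply/forallP => j; apply/implyP => qij; rewrite !ffunE -hat_rel_label.
  by apply: H; rewrite mem_ledges !mem_nth.
rewrite mem_ledges => /and3P[xA yA qxy].
have ix : (index x A < size A)%N by rewrite index_mem.
have iy : (index y A < size A)%N by rewrite index_mem.
have /forallP/(_ (Ordinal iy)) := H (Ordinal ix).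
by rewrite !ffunE -hat_rel_label /= !nth_index// qxy.
Qed.

Lemma hat_expect_ind (P : fposet) (A : seq nat) (q : rel nat) :
  uniq A -> (forall x, x \in A -> (x < fp_n P)%N) ->
  hat_expect P (fun x => (all (fun e => x e == q e.1 e.2)
    [seq (x, y) | x <- A, y <- A])%:R) = tind R (lposet_code A q) P.
Proof.
move=> uA ltA; rewrite /tind ltnNge (size_labels uA ltA) /=.
apply: (@hat_expect_restr R P A uA ltA) => s; congr _%:R.
congr nat_of_bool; apply/allP/forallP => /= [H i|H [x y]].
  apply/forallP => j; rewrite !ffunE -hat_rel_label eq_sym.
  apply: (H (_, _)); apply/allpairsP; exists (nth 0 A i, nth 0 A j).
  by rewrite !mem_nth.
move=> /allpairsP[[u v] /= [uA' vA [-> ->]]].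
have ix : (index u A < size A)%N by rewrite index_mem.
have iy : (index v A < size A)%N by rewrite index_mem.
have /forallP/(_ (Ordinal iy)) := H (Ordinal ix).
by rewrite !ffunE -hat_rel_label /= !nth_index// eq_sym.
Qed.

(** With [M] maps, [F] injections, [h] order-preserving maps and [ih] order-preserving injections,
    inclusion-exclusion gives [h + F <= M + ih]. Together with [ih <= F] and [ih <= h] this bounds
    the difference of [ih / F] and [h / M] on both sides. *)
Lemma tinj_tdens (Q P : fposet) : (0 < fp_n P)%N -> (fp_n Q <= fp_n P)%N ->
  `|tinj Q P - tdens R Q P| <=
    1 - (fp_n P ^_ fp_n Q)%:R / (fp_n P ^ fp_n Q)%:R.
Proof.
move=> P0 QP; rewrite /tinj /tdens !card_mkset -[X in _ / X%:R - _]cardsE.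
rewrite card_inj_ffuns !card_ord.
set h := #|(fun phi : {ffun _ -> _} => [forall x, _])|.
set ih := #|(fun phi : {ffun _ -> _} => injectiveb phi && _)|.
set M := (_ ^ _)%N; set F := (_ ^_ _)%N.
have M0 : (0 < M)%N by rewrite expn_gt0 P0.
have F0 : (0 < F)%N by rewrite ffact_gt0.
have ihF : (ih <= F)%N.
  rewrite /F -[X in (_ <= X ^_ _)%N]card_ord -[X in (_ <= _ ^_ X)%N]card_ord.
  rewrite -card_inj_ffuns cardsE; apply: subset_leq_card; apply/fintype.subsetP => f.
  by rewrite !unfold_in => /andP[].
have ihh : (ih <= h)%N.
  by apply: subset_leq_card; apply/fintype.subsetP => f; rewrite !unfold_in => /andP[].
have hM : (h + F <= M + ih)%N.
  rewrite /F -[X in (_ + X ^_ _ <= _)%N]card_ord -[X in (_ + _ ^_ X <= _)%N]card_ord.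
  rewrite -card_inj_ffuns cardsE -cardUI leq_add//.
    by rewrite /M -[X in (_ <= X ^ _)%N]card_ord -[X in (_ <= _ ^ X)%N]card_ord
      -card_ffun max_card.
  by apply: subset_leq_card; apply/fintype.subsetP => f; rewrite !unfold_in andbC.
have M0' : 0 < M%:R :> R by rewrite ltr0n.
have F0' : 0 < F%:R :> R by rewrite ltr0n.
have e1 : ih%:R / F%:R <= 1 :> R by rewrite ler_pdivrMr// mul1r ler_nat.
have e2 : ih%:R / M%:R <= h%:R / M%:R :> R.
  by rewrite ler_pM2r ?invr_gt0// ler_nat.
have e3 : h%:R / M%:R + F%:R / M%:R <= 1 + ih%:R / M%:R :> R.
  have : (h + F)%:R * M%:R^-1 <= (M + ih)%:R * M%:R^-1 :> R.
    by rewrite ler_pM2r ?invr_gt0// ler_nat.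
  by rewrite !natrD !mulrDl divff ?lt0r_neq0.
have e4 : ih%:R / M%:R = ih%:R / F%:R * (F%:R / M%:R) :> R.
  by rewrite mulrA divfK// lt0r_neq0.
have e5 : 0 <= ih%:R / F%:R :> R by rewrite divr_ge0// ler0n.
have e6 : 0 <= F%:R / M%:R :> R by rewrite divr_ge0// ler0n.
have e7 : F%:R / M%:R <= 1 :> R.
  have : F%:R / M%:R - ih%:R / M%:R <= 1 - h%:R / M%:R :> R by lra.
  lra.
rewrite ler_norml; apply/andP; split; nra.
Qed.

(** By induction on [k]: passing from [k] to [k + 1] multiplies the ratio by [1 - k / m], which
    tends to [1]. *)
Lemma cvg_ffact_ratio (m : nat -> nat) (k : nat) :
  (fun n => (m n)%:R^-1 : R) @ \oo --> (0 : R) ->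
  (\forall n \near \oo, (0 < m n)%N) ->
  (fun n => (m n ^_ k)%:R / (m n ^ k)%:R : R) @ \oo --> (1 : R).
Proof.
move=> m0 mpos; elim: k => [|k IH].
  by under eq_fun do rewrite ffactn0 expn0 divr1; exact: cvg_cst.
have cv : (fun n => (m n ^_ k)%:R / (m n ^ k)%:R * (1 - k%:R * (m n)%:R^-1) : R)
    @ \oo --> (1 * (1 - k%:R * 0) : R).
  by apply: cvgM => //; apply: cvgB; [exact: cvg_cst|apply: cvgMr].
rewrite mulr0 subr0 mulr1 in cv.
apply: cvg_trans cv; apply: near_eq_cvg.
(* The factor [m n - k] of the falling factorial is a truncated subtraction, equal to the real
   difference only once [k <= m n]. *)
have kltm : \forall n \near \oo, (k <= m n)%N.
  have : \forall n \near \oo, `|0 - (m n)%:R^-1| < k.+1%:R^-1 :> R.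
    by move/cvgrPdist_lt : m0; apply; rewrite invr_gt0 ltr0n.
  move=> H; near=> n; have mn : (0 < m n)%N by near: n.
  have : `|0 - (m n)%:R^-1| < k.+1%:R^-1 :> R by near: n.
  rewrite sub0r normrN ger0_norm ?invr_ge0 ?ler0n// ltf_pV2 ?posrE ?ltr0n//.
  by rewrite ltr_nat => /ltnW/ltnW.
near=> n; have mn : (0 < m n)%N by near: n.
have km : (k <= m n)%N by near: n.
have mn0 : (m n)%:R != 0 :> R by rewrite pnatr_eq0 -lt0n.
rewrite ffactnSr expnSr !natrM natrB// invfM mulrACA; congr (_ * _).
by rewrite mulrBl divff.
Unshelve. all: by end_near. Qed.

End densities.

(** * Finite relations and limits of containment probabilities *)

Lemma hat_rel_Nposet (P : fposet) (s : {perm 'I_(fp_n P)}) :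
  is_fposet P -> is_Nposet (hat_rel s).
Proof.
move=> [_ [irr tr]]; split => [i|i j k]; rewrite /hat_rel /=.
  by case: insubP => // a _ _; rewrite irr.
case: insubP => // a _ _; case: insubP => // b _ _; case: insubP => // c _ _.
exact: tr.
Qed.

(** The closure is the intersection of all transitive relations containing [S], so a transitive
    relation containing [S] contains it by definition. *)
Definition trans_closure (S : seq (nat * nat)) : rel nat := fun x y =>
  `[< forall r : cube, (forall i j k, r (i, j) -> r (j, k) -> r (i, k)) ->
      all r S -> r (x, y) >].

Lemma trans_closure_trans S x y z :
  trans_closure S x y -> trans_closure S y z -> trans_closure S x z.
Proof.
move=> /asboolP xy /asboolP yz; apply/asboolP => r tr rS.
by apply: (tr _ y); [exact: xy|exact: yz].
Qed.

Lemma sub_trans_closure S x y : (x, y) \in S -> trans_closure S x y.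
Proof. by move=> xyS; apply/asboolP => r _ /allP; exact. Qed.

(** The successor makes the ground set [iota 0 (label_bound S)] nonempty even when [S] is empty. *)
Definition label_bound (S : seq (nat * nat)) : nat :=
  (\max_(e <- S) maxn e.1 e.2).+1.

Definition closure_edges (S : seq (nat * nat)) :=
  ledges (iota 0 (label_bound S)) (trans_closure S).

Definition closure_poset (S : seq (nat * nat)) : fposet :=
  lposet_code (iota 0 (label_bound S)) (trans_closure S).

Definition acyclic (S : seq (nat * nat)) : bool :=
  `[< forall x, ~~ trans_closure S x x >].

Lemma ltn_label_bound S e :
  e \in S -> (e.1 < label_bound S)%N /\ (e.2 < label_bound S)%N.
Proof.
move=> eS; rewrite /label_bound !ltnS.
have : (maxn e.1 e.2 <= \max_(e <- S) maxn e.1 e.2)%N.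
  by apply: (leq_bigmax_seq (F := fun e => maxn e.1 e.2)).
by rewrite geq_max => /andP[].
Qed.

Lemma all_closure_edges S (r : cube) :
  (forall i j k, r (i, j) -> r (j, k) -> r (i, k)) ->
  all r (closure_edges S) = all r S.
Proof.
move=> tr; apply/allP/allP => H [x y].
  move=> xyS; have [/= xb yb] := ltn_label_bound xyS.
  by apply: H; rewrite mem_ledges !mem_iota xb yb sub_trans_closure.
rewrite mem_ledges => /and3P[_ _ /asboolP]; apply => //.
exact/allP.
Qed.

Lemma Nposet_acyclic S (r : cube) : is_Nposet r -> all r S -> acyclic S.
Proof.
move=> [irr tr] rS; apply/asboolP => x; apply/negP => /asboolP/(_ r tr rS).
by apply/negP; exact: irr.
Qed.

Lemma lposet_code_fposet A q : is_lposet A q -> is_fposet (lposet_code A q).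
Proof.
move=> [_ [A0 [irr tr]]]; split; first by rewrite /= lt0n size_eq0.
split => [i|j i k] /=; first by apply/negbTE/irr/mem_nth.
by apply: tr; exact: mem_nth.
Qed.

Lemma closure_poset_fposet S : acyclic S -> is_fposet (closure_poset S).
Proof.
move=> /asboolP acS; apply: lposet_code_fposet; split; first exact: iota_uniq.
split => //; split => [x _|x y z _ _ _]; first exact: acS.
exact: trans_closure_trans.
Qed.

Section limits.
Variable R : realType.
Implicit Types (u : nat -> fposet) (Pi : ppoint R) (S T : seq (nat * nat)).

Lemma eq_hat_expect P (f g : cube -> R) : is_fposet P ->
  (forall x, is_Nposet x -> f x = g x) -> hat_expect P f = hat_expect P g.
Proof.
move=> Pp fg; rewrite /hat_expect; congr (_ / _); apply: eq_bigr => s _.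
exact/fg/hat_rel_Nposet.
Qed.

Section large.
Variable u : nat -> fposet.
Hypothesis up : forall n, is_fposet (u n).
Hypothesis u0 : (fun n => (fp_n (u n))%:R^-1 : R) @ \oo --> (0 : R).

Lemma near_ltn_size k : \forall n \near \oo, (k < fp_n (u n))%N.
Proof.
have : \forall n \near \oo, `|0 - (fp_n (u n))%:R^-1| < k.+1%:R^-1 :> R.
  by move/cvgrPdist_lt : u0; apply; rewrite invr_gt0 ltr0n.
apply: filterS => n.
rewrite sub0r normrN ger0_norm ?invr_ge0 ?ler0n// ltf_pV2 ?posrE ?ltr0n//.
  by rewrite ltr_nat => /ltnW.
by have [] := up n.
Qed.

Lemma cvg_tinjB (Q : fposet) :
  (fun n => tinj R Q (u n) - tdens R Q (u n)) @ \oo --> (0 : R).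
Proof.
have upos : \forall n \near \oo, (0 < fp_n (u n))%N.
  by apply: nearW => n; have [] := up n.
have := cvg_ffact_ratio (fp_n Q) u0 upos => H.
apply/cvgrPdist_le => e e0; move/cvgrPdist_le : H => /(_ e e0) H.
near=> n; rewrite sub0r normrN; apply: le_trans (tinj_tdens _ _ _) _.
- by have [] := up n.
- by apply: ltnW; near: n; exact: near_ltn_size.
- by apply: le_trans (ler_norm _) _; near: n.
Unshelve. all: by end_near. Qed.

(** Once every label in [A] is below the size of [u n], the containment probability is exactly
    [tinj], and [tinj] and [tdens] have the same limits. *)
Lemma cvg_hat_hom A (q : rel nat) (l : R) : uniq A ->
  (fun n => hat_expect (u n) (fun x => (all x (ledges A q))%:R) : R) @ \oo --> l <->
  (fun n => tdens R (lposet_code A q) (u n)) @ \oo --> l.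
Proof.
move=> uA.
have ltA : \forall n \near \oo, forall x, x \in A -> (x < fp_n (u n))%N.
  have := near_ltn_size (\max_(x <- A) x); apply: filterS => n ltn x xA.
  by apply: leq_ltn_trans ltn; apply: (leq_bigmax_seq (F := id)).
have E : \forall n \near \oo,
    tinj R (lposet_code A q) (u n) =
    hat_expect (u n) (fun x => (all x (ledges A q))%:R).
  by apply: filterS ltA => n H; rewrite hat_expect_hom.
have D := cvg_tinjB (lposet_code A q).
split=> H.
- have : (fun n => hat_expect (u n) (fun x => (all x (ledges A q))%:R) -
      (tinj R (lposet_code A q) (u n) - tdens R (lposet_code A q) (u n)))
      @ \oo --> l - 0 by apply: cvgB.
  rewrite subr0; apply: cvg_trans; apply: near_eq_cvg.
  by apply: filterS E => n <-; rewrite subKr.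
- have : (fun n => (tinj R (lposet_code A q) (u n) - tdens R (lposet_code A q) (u n))
      + tdens R (lposet_code A q) (u n)) @ \oo --> 0 + l by apply: cvgD.
  rewrite add0r; apply: cvg_trans; apply: near_eq_cvg.
  by apply: filterS E => n <-; rewrite subrK.
Unshelve. all: by end_near. Qed.

Lemma near_hat_ind A (q : rel nat) : uniq A ->
  \forall n \near \oo, tind R (lposet_code A q) (u n) =
    hat_expect (u n) (fun x => (all (fun e => x e == q e.1 e.2)
      [seq (x, y) | x <- A, y <- A])%:R).
Proof.
move=> uA; have := near_ltn_size (\max_(x <- A) x); apply: filterS => n ltn.
rewrite hat_expect_ind// => x xA.
by apply: leq_ltn_trans ltn; apply: (leq_bigmax_seq (F := id)).
Qed.

End large.

(** A poset contains an acyclic [S] exactly when it contains its closure, whose density has a limit;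
    no poset contains a cyclic [S], whence the value [0]. *)
Definition limit_contain Pi S : R :=
  if acyclic S then Pi.1 (closure_poset S) else 0.

Lemma cvg_contain u Pi S : (forall n, is_fposet (u n)) -> fp_cvg u Pi ->
  Pi.2 = 0 ->
  (fun n => hat_expect (u n) (fun x => (all x S)%:R) : R) @ \oo -->
    limit_contain Pi S.
Proof.
move=> up [uPi u0] Pi0; rewrite Pi0 in u0; rewrite /limit_contain.
case: ifPn => [acS|/negP nacS].
  have := uPi _ (closure_poset_fposet acS).
  move/(cvg_hat_hom up u0 _ _ (iota_uniq _ _)).
  apply: cvg_trans; apply: near_eq_cvg; apply: nearW => n.
  apply: eq_hat_expect => // x [_ tr].
  by rewrite -/(closure_edges S) all_closure_edges.
rewrite (_ : (fun n => _) = fun=> 0); first exact: cvg_cst.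
apply/funext => n; rewrite (eq_hat_expect (g := fun=> 0))//.
  by rewrite /hat_expect big1// mul0r.
by move=> x xp; case: (boolP (all x S)) => // /(Nposet_acyclic xp)/nacS.
Qed.

Lemma hat_expectD P (f g : cube -> R) :
  hat_expect P (fun x => f x + g x) = hat_expect P f + hat_expect P g.
Proof. by rewrite /hat_expect big_split mulrDl. Qed.

Lemma hat_expectZ P c (f : cube -> R) :
  hat_expect P (fun x => c * f x) = c * hat_expect P f.
Proof. by rewrite /hat_expect -mulr_sumr mulrA. Qed.

(* Expanding in one coordinate at a time reduces a function of finitely many
   coordinates to a linear combination of the indicators of [all x S]. *)
Lemma cvg_local Pi (L : seq (nat * nat)) (g : cube -> R) : Pi.2 = 0 ->
  (forall x y : cube, (forall e, e \in L -> x e = y e) -> g x = g y) ->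
  exists l : R, forall u, (forall n, is_fposet (u n)) -> fp_cvg u Pi ->
    (fun n => hat_expect (u n) g) @ \oo --> l.
Proof.
move=> Pi0.
suff H S : (forall x y : cube, (forall e, e \in L -> x e = y e) -> g x = g y) ->
    exists l : R, forall u, (forall n, is_fposet (u n)) -> fp_cvg u Pi ->
    (fun n => hat_expect (u n) (fun x => (all x S)%:R * g x)) @ \oo --> l.
  move=> gL; have [l Hl] := H [::] gL; exists l => u up uPi.
  by have := Hl u up uPi; under eq_fun do under eq_fun do rewrite mul1r.
elim: L g S => [|e L IH] g S gL.
  exists (g xpred0 * limit_contain Pi S) => u up uPi.
  have : (fun n => g xpred0 * hat_expect (u n) (fun x => (all x S)%:R)) @ \oo -->
    g xpred0 * limit_contain Pi S by apply: cvgMr; exact: cvg_contain.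
  apply: cvg_trans; apply: near_eq_cvg; apply: nearW => n.
  rewrite -hat_expectZ; congr hat_expect; apply/funext => x.
  by rewrite mulrC (gL x xpred0).
pose upd c (x : cube) : cube := fun k => if k == e then c else x k.
have updL c x y : (forall k, k \in L -> x k = y k) -> g (upd c x) = g (upd c y).
  move=> xy; apply: gL => k; rewrite inE /upd; case: eqP => //= _; exact: xy.
have [l0 H0] := IH (fun x => g (upd false x)) S (updL false).
have [l1 H1] := IH (fun x => g (upd true x) - g (upd false x)) (e :: S)
  (fun x y xy => f_equal2 (fun a b => a - b) (updL true x y xy) (updL false x y xy)).
exists (l1 + l0) => u up uPi.
pose h T (f : cube -> R) n := hat_expect (u n) (fun x => (all x T)%:R * f x).
have : (fun n => h (e :: S) (fun x => g (upd true x) - g (upd false x)) n +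
    h S (fun x => g (upd false x)) n) @ \oo --> l1 + l0.
  by apply: cvgD; [exact: H1|exact: H0].
apply: cvg_trans; apply: near_eq_cvg; apply: nearW => n.
rewrite -hat_expectD; congr hat_expect; apply/funext => x /=.
have gE : g x = g (upd (x e) x).
  by apply: gL => k _; rewrite /upd; case: eqP => // ->.
rewrite [in RHS]gE; case: (x e); case: (all x S);
  rewrite ?mul1r ?mul0r ?addr0 ?add0r//.
by rewrite subrK.
Qed.

End limits.

(** * The topology of the cube *)

Section cylinders.
Local Notation space := {ptws (nat * nat)%type -> bool}.

Lemma cylinder_nbhs (z : space) (L : seq (nat * nat)) :
  nbhs z [set y : space | forall e, e \in L -> y e = z e].
Proof.
elim: L => [|a L IH]; first by apply: filterS filterT => y _ e; rewrite in_nil.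
have : nbhs z [set y : space | y a = z a].
  have := @proj_continuous _ (fun _ : nat * nat => bool) a z [set z a].
  by apply; rewrite /= discrete_topology.nbhs_principalE.
move=> za; near=> y => e; rewrite inE => /predU1P[->|eL]; first by near: y.
by move: e eL; near: y.
Unshelve. all: by end_near. Qed.

(** The sets containing a cylinder around [z] form a filter. It converges to [z] in each coordinate,
    hence in the product topology, so it contains every neighbourhood of [z]. *)
Lemma nbhs_cylinder (z : space) (U : set space) : nbhs z U ->
  exists L : seq (nat * nat),
    forall y : space, (forall e, e \in L -> y e = z e) -> U y.
Proof.
pose F : set_system space := [set A | exists L : seq (nat * nat),
    forall y : space, (forall e, e \in L -> y e = z e) -> A y].
have FF : Filter F.
  split.
  - by exists [::].
  - move=> A B [L LA] [M MB]; exists (L ++ M) => y H; split.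
      by apply: LA => e eL; apply: H; rewrite mem_cat eL.
    by apply: MB => e eM; apply: H; rewrite mem_cat eM orbT.
  - by move=> A B AB [L LA]; exists L => y /LA/AB.
suff : {ptws, F --> z} by apply.
apply/pointwise_cvgP => e A /nbhs_singleton Az.
by exists [:: e] => y H /=; rewrite H ?mem_head.
Qed.

Lemma cylinder_continuous (R : realType) (L : seq (nat * nat)) (f : space -> R) :
  (forall x y : space, (forall e, e \in L -> y e = x e) -> f y = f x) ->
  continuous f.
Proof.
move=> fL x; apply: (@cvg_trans _ ((fun=> f x) @ nbhs x)); last exact: cvg_cst.
apply: near_eq_cvg; have := cylinder_nbhs x L.
by apply: filterS => y H; rewrite (fL x y).
Qed.

(** Otherwise there are pairs agreeing on more and more coordinates with values of [f] at least
    [eps] apart. By compactness their first components cluster at some [z], and continuity of [f] at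
    [z] is contradicted. *)
Lemma continuous_cylinder_approx (R : realType) (f : space -> R) (eps : R)
    (enc : nat * nat -> nat) : continuous f -> 0 < eps ->
  exists N, forall x y : space,
    (forall e, (enc e < N)%N -> y e = x e) -> `|f x - f y| < eps.
Proof.
move=> fc e0; apply: contrapT => /forallNP H.
have {}H N : exists p : space * space,
    (forall e, (enc e < N)%N -> p.2 e = p.1 e) /\ eps <= `|f p.1 - f p.2|.
  have /existsNP[x /existsNP[y /not_implyP[xy /negP]]] := H N.
  by rewrite -leNgt => fxy; exists (x, y).
have [p pP] := choice H.
have cpt : compact [set: space].
  have := @tychonoff (nat * nat)%type (fun=> bool) (fun=> setT)
    (fun=> bool_compact).
  by congr compact; apply/seteqP; split.
have [] := cpt ((fst \o p) @ \oo) _ _; first exact: filterT.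
move=> z [_ zc].
have nz : nbhs z [set w : space | `|f z - f w| < eps / 2].
  by have /cvgrPdist_lt := fc z; apply; rewrite divr_gt0.
have [L Lz] := nbhs_cylinder nz.
(* [N0] exceeds the codes of all coordinates in [L]: for [n >= N0], if the first member of the pair
   lies in the cylinder of [z], so does the second. *)
pose N0 := (\max_(e <- L) enc e).+1.
have [] := zc [set w | exists2 n, (N0 <= n)%N & w = (p n).1] _ _
  (cylinder_nbhs z L).
  by exists N0 => // n /= Nn; exists n.
move=> _ [[n Nn ->] /= nL]; have [pn] := pP n.
have := Lz _ nL; have : `|f z - f (p n).2| < eps / 2.
  apply: Lz => e eL; rewrite pn ?nL//; apply: leq_trans Nn; rewrite ltnS.
  by apply: (leq_bigmax_seq (F := enc)).
move=> /= a b; apply/negP; rewrite -ltNge.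
rewrite (_ : f (p n).1 - f (p n).2 =
  (f z - f (p n).2) - (f z - f (p n).1)); last by lra.
by apply: le_lt_trans (ler_normB _ _) _; lra.
Qed.

End cylinders.

(** * Laws on the cube *)

Lemma measurable_all (d : measure_display) (O : measurableType d) (I : eqType)
    (E : O -> I -> bool) (S : seq I) :
  (forall i, i \in S -> measurable [set w | E w i]) ->
  measurable [set w | all (E w) S].
Proof.
elim: S => [|i S IH] mE /=; first by rewrite set_true.
rewrite (_ : [set w | _] = [set w | E w i] `&` [set w | all (E w) S]).
  apply: measurableI; first exact/mE/mem_head.
  by apply: IH => j jS; apply: mE; rewrite inE jS orbT.
by apply/seteqP; split => w /= => [/andP[]|[-> ->]].
Qed.

Lemma measurable_agree (d : measure_display) (O : measurableType d)
    (X : O -> cube) (b : cube) (L : seq (nat * nat)) :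
  (forall ij, measurable [set w | X w ij]) ->
  measurable [set w | all (fun e => X w e == b e) L].
Proof.
move=> mX; apply: (measurable_all (E := fun w e => X w e == b e)) => ij _.
case: (b ij); first by under eq_set do rewrite eqb_id.
rewrite (_ : [set w | _] = ~` [set w | X w ij]); first exact: measurableC.
by apply/seteqP; split => w /=; [move/eqP => ->|move/negP/negbTE/eqP].
Qed.

Section laws.
Variable R : realType.
Local Open Scope ereal_scope.

(** The events [all x S] are closed under intersection, by concatenating lists, and generate the
    sigma-algebra, so Dynkin's theorem applies. Measurability of the two preimages is carried along
    the induction because complements and unions need it. *)
Lemma same_law_contain (d1 d2 : measure_display) (O1 : measurableType d1)
    (P1 : probability O1 R) (X1 : O1 -> cube) (O2 : measurableType d2)
    (P2 : probability O2 R) (X2 : O2 -> cube) :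
  (forall ij, measurable [set w | X1 w ij]) ->
  (forall ij, measurable [set w | X2 w ij]) ->
  (forall S, P1 [set w | all (X1 w) S] = P2 [set w | all (X2 w) S]) ->
  same_law P1 X1 P2 X2.
Proof.
move=> m1 m2 P12 B mB.
pose G : set (set cube) := [set C | exists S, C = [set x : cube | all x S]].
have GB : <<s G >> B.
  apply: mB; split; first exact: smallest_sigma_algebra.
  move=> _ [ij ->]; apply: sub_sigma_algebra; exists [:: ij].
  by apply/seteqP; split => x /=; rewrite andbT.
suff [] : [/\ measurable (X1 @^-1` B), measurable (X2 @^-1` B) &
  P1 (X1 @^-1` B) = P2 (X2 @^-1` B)] by [].
apply: (@dynkin_induction _ (g_sigma_algebraType G) G (fun B =>
  [/\ measurable (X1 @^-1` B), measurable (X2 @^-1` B) &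
  P1 (X1 @^-1` B) = P2 (X2 @^-1` B)])) GB => //.
- move=> _ _ [S ->] [T ->]; exists (S ++ T); apply/seteqP.
  by split => x /=; rewrite all_cat => /andP.
- by rewrite !preimage_setT; split => //; rewrite !probability_setT.
- by move=> _ [S ->]; split => /=;
    [exact: measurable_all|exact: measurable_all|exact: P12].
- move=> C _ [mC1 mC2 PC]; rewrite -!preimage_setC; split.
  + exact: measurableC.
  + exact: measurableC.
  + by rewrite !probability_setC// PC.
- move=> F _ tF H.
  have mF1 n : measurable (X1 @^-1` F n) by have [] := H n.
  have mF2 n : measurable (X2 @^-1` F n) by have [] := H n.
  rewrite !preimage_bigcup; split; [exact: bigcup_measurable|exact: bigcup_measurable|].
  have triv (O : Type) (X : O -> cube) : trivIset setT (fun n => X @^-1` F n).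
    move=> i j _ _ [w [Fi Fj]]; apply: tF => //; exists (X w); split; done.
  rewrite !measure_bigcup//; apply: eq_eseriesr => n _.
  by have [] := H n.
Qed.

(** The indicator of an event on finitely many coordinates is continuous and bounded on the cube,
    hence an admissible test function. *)
Lemma cvg_dist_prob (u : nat -> fposet) (d : measure_display)
    (O : measurableType d) (Pr : probability O R) (X : O -> cube)
    (L : seq (nat * nat)) (b : cube -> bool) :
  cvg_dist u Pr X ->
  (forall x y : cube, (forall e, e \in L -> y e = x e) -> b y = b x) ->
  measurable [set w | b (X w)] ->
  (fun n => hat_expect (u n) (fun x => (b x)%:R) : R) @ \oo -->
    fine (Pr [set w | b (X w)]).
Proof.
move=> uX bL mb.
have := uX (fun x => (b x)%:R : R).
have -> : \int[Pr]_w ((b (X w))%:R : R)%:E = Pr [set w | b (X w)].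
  rewrite -[X in Pr X]setIT -integral_indic//; apply: eq_integral => w _.
  rewrite indicE; congr (_%:R%:E); congr nat_of_bool.
  by apply/idP/idP; rewrite inE.
rewrite -(fineK (fin_num_measure Pr _ mb)) => /(_ _ _)/fine_cvg; apply.
- by apply: (cylinder_continuous (L := L)) => x y xy; rewrite (bL x y).
- by exists 1%R => x; case: (b x); rewrite ?normr1 ?normr0.
Qed.

Lemma cvg_dist_contain u (d : measure_display) (O : measurableType d)
    (Pr : probability O R) (X : O -> cube) (S : seq (nat * nat)) :
  cvg_dist u Pr X -> (forall ij, measurable [set w | X w ij]) ->
  (fun n => hat_expect (u n) (fun x => (all x S)%:R) : R) @ \oo -->
    fine (Pr [set w | all (X w) S]).
Proof.
move=> uX mX; apply: (cvg_dist_prob (L := S) (b := fun x => all x S)) => //.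
- by move=> x y xy; exact: eq_in_all.
- exact: measurable_all.
Qed.

Lemma cvg_dist_agree u (d : measure_display) (O : measurableType d)
    (Pr : probability O R) (X : O -> cube) (b : cube) (L : seq (nat * nat)) :
  cvg_dist u Pr X -> (forall ij, measurable [set w | X w ij]) ->
  (fun n => hat_expect (u n) (fun x => (all (fun e => x e == b e) L)%:R) : R)
    @ \oo --> fine (Pr [set w | all (fun e => X w e == b e) L]).
Proof.
move=> uX mX; apply: (cvg_dist_prob (L := L)
  (b := fun x => all (fun e => x e == b e) L)) => //.
- by move=> x y xy; apply: eq_in_all => e /xy ->.
- exact: measurable_agree.
Qed.

End laws.

(** * Independence *)

Section independence.
Variable R : realType.
Local Open Scope ereal_scope.
Context (dO dT : measure_display) (O : measurableType dO) (Pr : probability O R)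
  (T : measurableType dT) (nu : probability T R) (U : pointedType)
  (G : set (set U)) (Y : O -> T) (Z : O -> g_sigma_algebraType G).
Hypothesis mY : measurable_fun setT Y.
Hypothesis mZ : measurable_fun setT Z.
Hypothesis GI : setI_closed G.
Hypothesis lawY : forall A, measurable A -> Pr (Y @^-1` A) = nu A.
Hypothesis indep : forall A C, measurable A -> G C ->
  Pr (Y @^-1` A `&` Z @^-1` C) = nu A * Pr (Z @^-1` C).

Let mYs A : measurable A -> measurable (Y @^-1` A).
Proof. by move=> mA; rewrite -[X in measurable X]setTI; exact: mY. Qed.

Let mZs (C : set (g_sigma_algebraType G)) :
  measurable C -> measurable (Z @^-1` C).
Proof. by move=> mC; rewrite -[X in measurable X]setTI; exact: mZ. Qed.

(** Dynkin induction in [C] with [A] fixed, starting from independence on the generators [G]. *)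
Lemma indep_sigma A (C : set (g_sigma_algebraType G)) :
  measurable A -> measurable C ->
  Pr (Y @^-1` A `&` Z @^-1` C) = nu A * Pr (Z @^-1` C).
Proof.
move=> mA mC.
apply: (@dynkin_induction _ (g_sigma_algebraType G) G (fun C =>
  Pr (Y @^-1` A `&` Z @^-1` C) = nu A * Pr (Z @^-1` C))) mC => //.
- by rewrite preimage_setT setIT probability_setT mule1 lawY.
- by move=> B GB; exact: indep.
- move=> B mB IH; rewrite -preimage_setC -setDE.
  rewrite measureD; last 3 first.
  + exact: mYs.
  + exact: mZs.
  + by rewrite -ge0_fin_numE// fin_num_measure//; exact: mYs.
  transitivity (nu A - nu A * Pr (Z @^-1` B)); first by rewrite -IH -lawY.
  rewrite probability_setC; last exact: mZs.
  rewrite muleBr ?mule1//.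
  exact: fin_num_measure.
- move=> F mF tF IH; rewrite preimage_bigcup setI_bigcupr.
  have tZ : trivIset setT (fun n => Z @^-1` F n).
    by move=> i j _ _ [w [Fi Fj]]; apply: tF => //; exists (Z w); split.
  have mFZ n : measurable (Z @^-1` F n) by exact: mZs.
  have mFYZ n : measurable (Y @^-1` A `&` Z @^-1` F n).
    by apply: measurableI => //; exact: mYs.
  have tYZ : trivIset setT (fun n => Y @^-1` A `&` Z @^-1` F n).
    exact: trivIset_setIl.
  have nuA : (fine (nu A))%:E = nu A by rewrite fineK// fin_num_measure.
  rewrite !measure_bigcup// -nuA -nneseriesZl//.
  by apply: eq_eseriesr => n _; rewrite nuA; exact: IH.
Qed.

Let V : measurableType _ := g_sigma_algebraType G.

(** By uniqueness of product measures the law of the pair is the product of [nu] and the law of [Z];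
    Tonelli then gives both orders of integration. *)
Lemma indep_tonelli (g : T * V -> \bar R) :
  measurable_fun setT g -> (forall p, 0 <= g p) ->
  \int[Pr]_w g (Y w, Z w) = \int[nu]_y \int[Pr]_w g (y, Z w) /\
  \int[Pr]_w g (Y w, Z w) = \int[Pr]_w \int[nu]_y g (y, Z w).
Proof.
move=> mg g0.
pose Zf : {mfun O >-> V} :=
  HB.pack Z (isMeasurableFun.Build _ _ _ _ _ mZ).
have mYZ : measurable_fun setT (fun w => (Y w, Z w)) by exact: measurable_fun_pair.
pose YZf : {mfun O >-> (T * V)%type} :=
  HB.pack (fun w => (Y w, Z w)) (isMeasurableFun.Build _ _ _ _ _ mYZ).
have E : \int[Pr]_w g (Y w, Z w) = \int[nu \x distribution Pr Zf]_p g p.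
  transitivity (\int[distribution Pr YZf]_p g p).
    by rewrite ge0_integral_distribution.
  apply: eq_measure_integral => A mA _.
  by apply/esym/product_measure_unique => // B C mB mC; exact: indep_sigma.
have in1 y : \int[distribution Pr Zf]_z g (y, z) = \int[Pr]_w g (y, Z w).
  by rewrite ge0_integral_distribution//; exact: measurable_fun_pair2.
split.
  by rewrite E fubini_tonelli1//; apply: eq_integral => y _; exact: in1.
rewrite E fubini_tonelli2// ge0_integral_distribution//.
  exact: measurable_fun_fubini_tonelli_G.
by move=> z; exact: integral_ge0.
Qed.

End independence.

(** * Sigma-algebras generated by finite-dimensional rectangles *)

Section rectangles.
Context (R : realType) (d : measure_display) (S : measurableType d).
Implicit Types (K : pred nat) (L : pred (nat * nat)).

(** Only coordinates in [K] and [L] may be constrained, so a sampled variable outside them is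
    independent of the generated sigma-algebra. The lists [F] and [G] carry the finitely many
    genuine constraints. *)
Definition rectangles K L : set (set ((nat -> S) * (nat * nat -> R))) :=
  [set C | exists (A : nat -> set S) (B : nat * nat -> set R)
      (F : seq nat) (G : seq (nat * nat)),
    [/\ (forall i, measurable (A i)) /\ (forall k, measurable (B k)),
        uniq F /\ uniq G,
        {subset F <= K} /\ {subset G <= L},
        (forall i, i \notin F -> A i = setT) /\
        (forall k, k \notin G -> B k = setT) &
        C = [set z | (forall i, A i (z.1 i)) /\ (forall k, B k (z.2 k))]]].

Local Notation rectT K L := (g_sigma_algebraType (rectangles K L)).

Lemma rectangles_setI K L : setI_closed (rectangles K L).
Proof.
move=> _ _ [A [B [F [G [[mA mB] [uF uG] [FK GL] [AF BG] ->]]]]]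
  [A' [B' [F' [G' [[mA' mB'] [uF' uG'] [FK' GL'] [AF' BG'] ->]]]]].
exists (fun i => A i `&` A' i), (fun k => B k `&` B' k),
  (undup (F ++ F')), (undup (G ++ G')); split.
- by split => *; exact: measurableI.
- by rewrite !undup_uniq.
- split => x; rewrite mem_undup mem_cat => /orP[].
  + exact: FK.
  + exact: FK'.
  + exact: GL.
  + exact: GL'.
- split => x; rewrite mem_undup mem_cat negb_or => /andP[a b].
    by rewrite AF// AF'// setIT.
  by rewrite BG// BG'// setIT.
- apply/seteqP; split => z /=.
    by move=> [[Az Bz] [Az' Bz']]; split.
  by move=> [Az Bz]; split; split => i; (have [] := Az i) || (have [] := Bz i).
Qed.

Lemma measurable_rect_fst K L i : K i ->
  measurable_fun setT (fun z : rectT K L => z.1 i).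
Proof.
move=> Ki _ A mA; rewrite setTI; apply: sub_sigma_algebra.
exists (fun j => if j == i then A else setT), (fun=> setT), [:: i], [::].
split => //.
- by split => // j; case: ifP.
- by split => // j; rewrite inE => /eqP ->.
- by split => // j; rewrite inE => /negbTE ->.
- apply/seteqP; split => z /=; last by move=> [/(_ i)]; rewrite eqxx.
  by move=> Az; split => // j; case: eqP => // ->.
Qed.

Lemma measurable_rect_snd K L k : L k ->
  measurable_fun setT (fun z : rectT K L => z.2 k).
Proof.
move=> Lk _ B mB; rewrite setTI; apply: sub_sigma_algebra.
exists (fun=> setT), (fun j => if j == k then B else setT), [::], [:: k].
split => //.
- by split => // j; case: ifP.
- by split => // j; rewrite inE => /eqP ->.
- by split => // j; rewrite inE => /negbTE ->.
- apply/seteqP; split => z /=; last by move=> [_ /(_ k)]; rewrite eqxx.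
  by move=> Bz; split => // j; case: eqP => // ->.
Qed.

(** A rectangle constrains finitely many coordinates, so its preimage is a finite intersection of
    preimages under coordinates. *)
Lemma measurable_into_rect (d' : measure_display) (T : measurableType d') K L
    (h : T -> rectT K L) :
  (forall i, K i -> measurable_fun setT (fun t => (h t).1 i)) ->
  (forall k, L k -> measurable_fun setT (fun t => (h t).2 k)) ->
  measurable_fun setT h.
Proof.
move=> h1 h2; apply: (@measurability _ _ T (rectT K L) setT h (rectangles K L)) => //.
move=> _ [_ [A [B [F [G [[mA mB] [uF uG] [FK GL] [AF BG] ->]]]]] <-].
rewrite setTI [X in measurable X](_ : _ =
    [set t | all (fun i => `[< A i ((h t).1 i) >]) F] `&`
    [set t | all (fun k => `[< B k ((h t).2 k) >]) G]).
  apply: measurableI.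
    apply: (measurable_all (E := fun t i => `[< A i ((h t).1 i) >])) => i iF.
    have := h1 _ (FK _ iF) measurableT _ (mA i); rewrite setTI.
    by congr measurable; apply/seteqP; split => t /asboolP.
  apply: (measurable_all (E := fun t k => `[< B k ((h t).2 k) >])) => k kG.
  have := h2 _ (GL _ kG) measurableT _ (mB k); rewrite setTI.
  by congr measurable; apply/seteqP; split => t /asboolP.
apply/seteqP; split => t /=.
  by move=> [At Bt]; split; apply/allP => i _; apply/asboolP.
move=> [/allP At /allP Bt]; split => [i|k].
  by case: (boolP (i \in F)) => [/At/asboolP//|/AF ->].
by case: (boolP (k \in G)) => [/Bt/asboolP//|/BG ->].
Qed.

End rectangles.

Notation rectT R S K L := (g_sigma_algebraType (@rectangles R _ S K L)).

(** * Independence of the sampled variables *)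

Section sample.
Context (R : realType) (d dO : measure_display) (S : measurableType d)
  (mu : probability S R) (O : measurableType dO) (Pr : probability O R)
  (X : nat -> O -> S) (xi : nat * nat -> O -> R).
Hypothesis smp : pinf_sample mu Pr X xi.
Implicit Types (K : pred nat) (L : pred (nat * nat)).
Local Open Scope ereal_scope.

Let mX i : measurable_fun setT (X i). Proof. by have [] := smp. Qed.
Let mxi k : measurable_fun setT (xi k). Proof. by have [_ []] := smp. Qed.

Lemma sample_rect (A : nat -> set S) (B : nat * nat -> set R)
    (F : seq nat) (G : seq (nat * nat)) :
  (forall i, measurable (A i)) -> (forall k, measurable (B k)) ->
  uniq F -> uniq G ->
  (forall i, i \notin F -> A i = setT) -> (forall k, k \notin G -> B k = setT) ->
  Pr [set w | (forall i, A i (X i w)) /\ (forall k, B k (xi k w))] =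
  (\prod_(i <- F) mu (A i)) *
  (\prod_(k <- G) lebesgue_measure (B k `&` `[0%R, 1%R]%classic)).
Proof.
move=> mA mB uF uG AF BG; rewrite -(smp.2.2 F G A B uF uG mA mB); congr (Pr _).
apply/seteqP; split => w /=; first by move=> [Aw Bw]; split => ? _ /=.
move=> [Aw Bw]; split => [i|k].
  by case: (boolP (i \in F)) => [/Aw//|/AF ->].
by case: (boolP (k \in G)) => [/Bw//|/BG ->].
Qed.

(** The function is the same for all [K] and [L]; only the sigma-algebra on its codomain changes. *)
Definition joint K L : O -> rectT R S K L :=
  fun w => (fun i => X i w, fun k => xi k w).

Lemma measurable_joint K L : measurable_fun setT (joint K L).
Proof. by apply: measurable_into_rect => *; [exact: mX|exact: mxi]. Qed.

Lemma law_X i A : measurable A -> Pr (X i @^-1` A) = mu A.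
Proof.
move=> mA; have := @sample_rect (fun j => if j == i then A else setT)
  (fun=> setT) [:: i] [::].
rewrite big_seq1 big_nil mule1 eqxx => <- //.
- congr (Pr _); apply/seteqP; split => w /=; last by move=> [/(_ i)]; rewrite eqxx.
  by move=> Aw; split => // j; case: eqP => // ->.
- by move=> j; case: ifP.
- by move=> j; rewrite inE => /negbTE ->.
Qed.

Lemma law_xi k B : measurable B ->
  Pr (xi k @^-1` B) = lebesgue_measure (B `&` `[0%R, 1%R]%classic).
Proof.
move=> mB; have := @sample_rect (fun=> setT)
  (fun j => if j == k then B else setT) [::] [:: k].
rewrite big_seq1 big_nil mul1e eqxx => <- //.
- congr (Pr _); apply/seteqP; split => w /=; last by move=> [_ /(_ k)]; rewrite eqxx.
  by move=> Bw; split => // j; case: eqP => // ->.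
- by move=> j; case: ifP.
- by move=> j; rewrite inE => /negbTE ->.
Qed.

(** As [k] is outside [K], the constraint on [X k] extends the rectangle by a new coordinate, and
    the product formula gains the factor [mu A]. *)
Lemma indep_X K L k A C : ~~ K k -> measurable A -> rectangles K L C ->
  Pr (X k @^-1` A `&` joint K L @^-1` C) = mu A * Pr (joint K L @^-1` C).
Proof.
move=> Kk mA [A' [B [F [G [[mA' mB] [uF uG] [FK GL] [AF BG] ->]]]]].
have kF : k \notin F by apply: contra Kk => /FK.
rewrite (_ : X k @^-1` A `&` _ = [set w |
    (forall i, (if i == k then A else A' i) (X i w)) /\
    (forall k, B k (xi k w))]); last first.
  apply/seteqP; split => w /=.
    by move=> [Aw [Aw' Bw]]; split => // i; case: eqP => [->|].
  move=> [Aw Bw]; split; first by have := Aw k; rewrite eqxx.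
  split => // i; have := Aw i; case: eqP => // -> _.
  by rewrite AF.
rewrite (@sample_rect (fun i => if i == k then A else A' i) B (k :: F) G)//.
- rewrite (sample_rect mA' mB uF uG AF BG) big_cons eqxx muleA; congr (_ * _ * _).
  by apply: eq_big_seq => i iF; case: eqP => // ik; rewrite -ik iF in kF.
- by move=> i; case: ifP.
- by rewrite /= kF.
- by move=> i; rewrite inE negb_or => /andP[/negbTE -> /AF].
Qed.

Lemma indep_xi K L k B C : ~~ L k -> measurable B -> rectangles K L C ->
  Pr (xi k @^-1` B `&` joint K L @^-1` C) =
  lebesgue_measure (B `&` `[0%R, 1%R]%classic) * Pr (joint K L @^-1` C).
Proof.
move=> Lk mB [A [B' [F [G [[mA mB'] [uF uG] [FK GL] [AF BG] ->]]]]].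
have kG : k \notin G by apply: contra Lk => /GL.
rewrite (_ : xi k @^-1` B `&` _ = [set w | (forall i, A i (X i w)) /\
    (forall i, (if i == k then B else B' i) (xi i w))]); last first.
  apply/seteqP; split => w /=.
    by move=> [Bw [Aw Bw']]; split => // i; case: eqP => [->|].
  move=> [Aw Bw]; split; first by have := Bw k; rewrite eqxx.
  split => // i; have := Bw i; case: eqP => // -> _.
  by rewrite BG.
rewrite (@sample_rect A (fun i => if i == k then B else B' i) F (k :: G))//.
- rewrite (sample_rect mA mB' uF uG AF BG) big_cons eqxx muleCA; congr (_ * (_ * _)).
  by apply: eq_big_seq => i iG; case: eqP => // ik; rewrite -ik iG in kG.
- by move=> i; case: ifP.
- by rewrite /= kG.
- by move=> i; rewrite inE negb_or => /andP[/negbTE -> /BG].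
Qed.

End sample.

Lemma measurable_fun_nat_of_bool (R : realType) (d : measure_display)
    (T : measurableType d) (b : T -> bool) :
  measurable [set t | b t] -> measurable_fun setT (fun t => (b t)%:R : R).
Proof.
move=> mb; apply: (eq_measurable_fun (\1_[set t | b t] : T -> R)).
  move=> t _; rewrite indicE; congr (_%:R); congr nat_of_bool.
  by apply/idP/idP; rewrite inE.
exact: measurable_indic.
Qed.

Lemma measurable_set_ltr (R : realType) (d : measure_display)
    (T : measurableType d) (f g : T -> R) :
  measurable_fun setT f -> measurable_fun setT g ->
  measurable [set t | f t < g t].
Proof.
move=> mf mg; have H := measurable_fun_ltr mf mg.
by have := H measurableT [set true]; rewrite setTI; apply.
Qed.

(** * Integrating out the sampled variables *)

Section sample_integrals.
Context (R : realType) (d dO : measure_display) (S : measurableType d)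
  (mu : probability S R) (O : measurableType dO) (Pr : probability O R)
  (X : nat -> O -> S) (xi : nat * nat -> O -> R).
Hypothesis smp : pinf_sample mu Pr X xi.
Local Open Scope ereal_scope.

(** The outermost integral of [iter_int] runs over the last coordinate. The corresponding [X n] is
    independent of the earlier ones, so Tonelli merges that integral with the expectation given by
    induction. *)
Lemma iter_int_sample n (f : (nat -> S) -> \bar R) :
  measurable_fun setT
    (fun z : rectT R S [pred i | (i < n)%N] pred0 => f z.1) ->
  (forall x, 0 <= f x) ->
  (forall x y, (forall i, (i < n)%N -> x i = y i) -> f x = f y) ->
  iter_int mu n f = \int[Pr]_w f (fun i => X i w).
Proof.
elim: n f => [|n IH] f mf f0 fn /=.
  under eq_integral do rewrite (fn _ (fun=> point))//.
  by rewrite integral_cst// [X in _ * X](probability_setT Pr) mule1.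
pose upd (y : S) (x : nat -> S) i := if i == n then y else x i.
pose g (p : S * rectT R S [pred i | (i < n)%N] pred0) := f (upd p.1 p.2.1).
have mg : measurable_fun setT g.
  apply: (@measurableT_comp _ _ _ _ _ _ _ _
    (fun p : S * rectT R S [pred i | (i < n)%N] pred0 =>
     (upd p.1 p.2.1, p.2.2) : rectT R S [pred i | (i < n.+1)%N] pred0) mf).
  apply: measurable_into_rect => // i /= iln; rewrite /upd.
  have [_|ni] := eqVneq i n; first exact: measurable_fst.
  have iK : [pred i | (i < n)%N] i by rewrite /= ltn_neqAle ni.
  exact: (measurableT_comp (measurable_rect_fst iK) measurable_snd).
transitivity (\int[mu]_y \int[Pr]_w g (y, joint X xi _ _ w)).
  apply: eq_integral => y _; rewrite IH//.
  - exact: (measurable_fun_pair2 y mg).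
  - move=> x x' xx'; apply: fn => i ilt; rewrite -!/(upd y _ i) /upd.
    by case: eqP => // /eqP ni; apply: xx'; rewrite ltn_neqAle ni.
have nK : ~~ [pred i | (i < n)%N] n by rewrite /= ltnn.
have [<- _] := @indep_tonelli _ _ _ _ Pr _ mu _ _ (X n)
  (joint X xi [pred i | (i < n)%N] pred0) (smp.1 n)
  (@measurable_joint _ _ _ _ _ _ _ _ _ smp _ _)
  (@rectangles_setI _ _ _ _ _) (law_X smp n)
  (fun A C mA => @indep_X _ _ _ _ _ _ _ _ _ smp _ _ n A C nK mA) g mg (fun p => f0 _).
apply: eq_integral => w _; rewrite /g /=; congr f.
by apply/funext => i; rewrite /upd /=; case: eqP => // ->.
Qed.

Variable W : S -> S -> R.
Hypothesis mW : measurable_fun setT (fun p : S * S => W p.1 p.2).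
Hypothesis W01 : forall x y, (0 <= W x y <= 1)%R.

Let measurable_W (d' : measure_display) (T : measurableType d') (a b : T -> S) :
  measurable_fun setT a -> measurable_fun setT b ->
  measurable_fun setT (fun t => W (a t) (b t)).
Proof.
move=> ma mb.
exact: (measurableT_comp mW (measurable_fun_pair ma mb)).
Qed.

Lemma prob_xi_lt e (c : R) : (0 <= c <= 1)%R ->
  Pr (xi e @^-1` [set y | (y < c)%R]) = c%:E.
Proof.
move=> /andP[c0 c1]; rewrite (law_xi smp); last first.
  by rewrite -set_itvNyo; exact: measurable_itv.
rewrite (_ : _ `&` _ = `[0%R, c[%classic).
  rewrite lebesgue_measure_itv/= lte_fin; case: ltP => [_|]; first by rewrite sube0.
  by move=> c0'; congr (_%:E); apply/eqP; rewrite eq_le c0 c0'.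
apply/seteqP; split => y /=; rewrite !in_itv /=.
  by move=> [-> /andP[->]].
by move=> /andP[-> yc]; rewrite yc /= (le_trans (ltW yc)).
Qed.

(** Edges are integrated out one at a time: [xi e] is independent of all [X i] and of the [xi] of
    the other edges, so its indicator becomes a factor [W]. The function [phi] accumulates these
    factors, hence the general form. *)
Lemma integral_edges (G : seq (nat * nat)) (phi : (nat -> S) -> R) :
  uniq G ->
  measurable_fun setT (fun z : rectT R S predT pred0 => phi z.1) ->
  (forall x, 0 <= phi x)%R ->
  \int[Pr]_w (phi (X ^~ w) * (all (pinf_poset W X xi w) G)%:R)%:E =
  \int[Pr]_w (phi (X ^~ w) * \prod_(e <- G) W (X e.1 w) (X e.2 w))%:E.
Proof.
elim: G phi => [|e G IH] phi /=; first by under [in RHS]eq_fun do rewrite big_nil.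
move=> /andP[eG uG] mphi phi0.
pose V : measurableType _ := rectT R S predT [in G].
pose b (z : V) := all (fun e => z.2 e < W (z.1 e.1) (z.1 e.2))%R G.
pose g (p : R * V) := ((phi p.2.1 * (b p.2)%:R) *
  (p.1 < W (p.2.1 e.1) (p.2.1 e.2))%R%:R)%:E.
have m1 i : measurable_fun setT (fun z : V => z.1 i).
  exact: measurable_rect_fst.
have mphiV : measurable_fun setT (fun z : V => phi z.1).
  apply: (@measurableT_comp _ _ _ _ _ _ _ _
    (fun z : V => (z.1, z.2) : rectT R S predT pred0) mphi).
  by apply: measurable_into_rect => // i _; exact: m1.
have mb : measurable [set z : V | b z].
  apply: (measurable_all (E := fun (z : V) e =>
    (z.2 e < W (z.1 e.1) (z.1 e.2))%R)) => k kG.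
  apply: measurable_set_ltr; last exact: measurable_W.
  exact: measurable_rect_snd.
have mg : measurable_fun setT g.
  apply/measurable_EFinP; apply: measurable_funM.
    apply: (@measurableT_comp _ _ _ _ _ _ (fun z : V => phi z.1 * (b z)%:R)%R) => //.
    by apply: measurable_funM => //; exact: measurable_fun_nat_of_bool.
  apply: measurable_fun_nat_of_bool; apply: measurable_set_ltr => //.
  by apply: measurable_W; exact: (measurableT_comp (m1 _) measurable_snd).
have g0 p : 0 <= g p by rewrite lee_fin !mulr_ge0.
have mxie : measurable_fun setT (xi e) by have [_ []] := smp.
pose xf : {mfun O >-> R} := HB.pack (xi e) (isMeasurableFun.Build _ _ _ _ _ mxie).
have indep A C : measurable A -> rectangles predT [in G] C ->
    Pr (xi e @^-1` A `&` joint X xi predT [in G] @^-1` C) =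
    distribution Pr xf A * Pr (joint X xi predT [in G] @^-1` C).
  by move=> mA RC; rewrite (indep_xi smp eG mA RC) -(law_xi smp e mA).
have [_ gE] := @indep_tonelli _ _ _ _ Pr _ (distribution Pr xf) _ _ (xi e)
  (joint X xi predT [in G]) mxie (@measurable_joint _ _ _ _ _ _ _ _ _ smp _ _)
  (@rectangles_setI _ _ _ _ _) (fun A _ => erefl) indep g mg g0.
transitivity (\int[Pr]_w g (xi e w, joint X xi predT [in G] w)).
  apply: eq_integral => w _; congr (_%:E); rewrite /= -mulrA; congr (_ * _)%R.
  by rewrite mulrC -natrM mulnb.
rewrite gE.
transitivity (\int[Pr]_w ((phi (X ^~ w) * W (X e.1 w) (X e.2 w)) *
    (all (pinf_poset W X xi w) G)%:R)%:E).
  apply: eq_integral => w _; rewrite /g /=.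
  under eq_integral do rewrite EFinM.
  rewrite ge0_integralZl//; last 2 first.
  - apply/measurable_EFinP/measurable_fun_nat_of_bool.
    by rewrite -set_itvNyo; exact: measurable_itv.
  - by rewrite lee_fin mulr_ge0.
  rewrite [X in _ * X](_ : _ = (W (X e.1 w) (X e.2 w))%:E).
    by rewrite -EFinM mulrAC.
  rewrite -(prob_xi_lt e (W01 _ _)).
  rewrite -[RHS]/(distribution Pr xf _) -[X in distribution _ _ X]setIT.
  rewrite -integral_indic//.
    apply: eq_integral => y _; rewrite indicE; congr (_%:R%:E).
    by congr nat_of_bool; apply/idP/idP; rewrite inE.
  by rewrite -set_itvNyo; exact: measurable_itv.
rewrite (IH (fun x => phi x * W (x e.1) (x e.2))%R)//.
- by apply: eq_integral => w _; rewrite big_cons mulrA.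
- by apply: measurable_funM => //; apply: measurable_W; exact: measurable_rect_fst.
- by move=> x; rewrite mulr_ge0//; have /andP[] := W01 (x e.1) (x e.2).
Qed.

Lemma measurable_pinf ij : measurable [set w | pinf_poset W X xi w ij].
Proof.
have [mX [mxi _]] := smp.
by apply: measurable_set_ltr => //; exact: measurable_W.
Qed.

Lemma prob_edges (G : seq (nat * nat)) : uniq G ->
  Pr [set w | all (pinf_poset W X xi w) G] =
  \int[Pr]_w (\prod_(e <- G) W (X e.1 w) (X e.2 w))%:E.
Proof.
move=> uG; have := @integral_edges G (fun=> 1%R) uG (measurable_cst _) (fun=> ler01).
under [RHS]eq_integral do rewrite mul1r; move=> <-.
rewrite -[in LHS](setIT [set _ | _]) -integral_indic//; last first.
  by apply: measurable_all => *; exact: measurable_pinf.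
apply: eq_integral => w _; rewrite mul1r indicE; congr (_%:R%:E).
by congr nat_of_bool; apply/idP/idP; rewrite inE.
Qed.

End sample_integrals.

(** * The law of P(oo, W) *)

Lemma probability_eq_negligible (R : realType) (d : measure_display)
    (O : measurableType d) (Pr : probability O R) (A B N : set O) :
  measurable A -> measurable B -> Pr.-negligible N ->
  (forall w, ~ N w -> A w <-> B w) -> Pr A = Pr B.
Proof.
move=> mA mB [M [mM M0 NM]] AB.
have le (C D : set O) : measurable C -> measurable D ->
    (forall w, ~ N w -> C w -> D w) -> (Pr C <= Pr D)%E.
  move=> mC mD CD; rewrite -[leRHS]adde0 -M0.
  apply: (le_trans _ (measureU2 _ mD mM)); apply: le_measure; rewrite ?inE//.
    exact: measurableU.
  move=> w Cw; have [Nw|Nw] := pselect (N w); first by right; exact: NM.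
  by left; exact: CD.
by apply/eqP; rewrite eq_le !le// => w /AB[].
Qed.

Lemma prod_ledges_iota (R : realType) n (q : rel nat) (f : nat -> nat -> R) :
  \prod_(i < size (iota 0 n)) \prod_(j < size (iota 0 n) |
     q (nth 0 (iota 0 n) i) (nth 0 (iota 0 n) j)) f i j =
  \prod_(e <- ledges (iota 0 n) q) f e.1 e.2.
Proof.
have nE : size (iota 0 n) = n by rewrite size_iota.
(* The size is generalized first because the types of the indices depend on it. *)
move: (size (iota 0 n)) nE => m ->.
rewrite /ledges big_filter [in RHS]big_mkcond big_allpairs_dep /=.
have iE : iota 0 n = index_iota 0 n by rewrite /index_iota subn0.
rewrite [in RHS]iE big_mkord; apply: eq_bigr => i _.
rewrite [in RHS]big_mkord [LHS]big_mkcond; apply: eq_bigr => j _.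
by rewrite !nth_iota.
Qed.

Section pinf_law.
Context (R : realType) (d dO : measure_display) (S : measurableType d)
  (mu : probability S R) (O : measurableType dO) (Pr : probability O R)
  (X : nat -> O -> S) (xi : nat * nat -> O -> R)
  (prec : S -> S -> Prop) (W : S -> S -> R).
Hypothesis smp : pinf_sample mu Pr X xi.
Hypothesis oprec : ordered_prob prec.
Hypothesis kW : is_kernel prec W.
Local Open Scope ereal_scope.

Let mW : measurable_fun setT (fun p : S * S => W p.1 p.2).
Proof. by case: kW. Qed.
Let W01 x y : (0 <= W x y <= 1)%R. Proof. by case: kW => _ []. Qed.

(** As [xi >= 0], an edge forces [W > 0], hence [prec], which gives irreflexivity. Two consecutive
    edges force [W = 1] on the composite, and [xi < 1] makes it an edge. *)
Lemma pinf_Nposet w : (forall k, (0 <= xi k w < 1)%R) ->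
  is_Nposet (pinf_poset W X xi w).
Proof.
have [_ [_ [Wprec Wtr]]] := kW; have [irr _] := oprec.
move=> xi01; have W0 i j : (xi (i, j) w < W (X i w) (X j w) ->
    0 < W (X i w) (X j w))%R.
  by apply: le_lt_trans; have /andP[] := xi01 (i, j).
split => [i|i j k]; rewrite /pinf_poset /=.
  by apply/negP => /W0/Wprec; exact: irr.
move=> /W0 ij /W0 jk; rewrite (Wtr _ _ _ ij jk).
by have /andP[] := xi01 (i, k).
Qed.

Lemma xi_negligible :
  Pr.-negligible [set w | ~ forall k, (0 <= xi k w < 1)%R].
Proof.
have m01 : measurable (~` `[0%R, 1%R[%classic : set R).
  by apply: measurableC; exact: measurable_itv.
pose dec n : nat * nat := odflt (0, 0)%N (unpickle n).
apply: (@negligibleS _ _ _ _ (\bigcup_n (xi (dec n) @^-1` (~` `[0%R, 1%R[)))).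
  move=> w /existsNP[k xik]; exists (pickle k) => //=.
  by rewrite /dec pickleK /= in_itv /=.
apply: negligible_bigcup => n; apply/negligibleP.
  rewrite -[X in measurable X]setTI.
  by have [_ [mxi _]] := smp; exact: mxi.
(* The law lives on the closed unit interval, so only the endpoint [1] remains, a null set. *)
rewrite [LHS](law_xi smp)// (_ : _ `&` _ = [set 1%R]) ?lebesgue_measure_set1//.
apply/seteqP; split => y /=; rewrite !in_itv /=.
  move=> [/negP + /andP[y0 y1]]; rewrite y0 /= -leNgt => y1'.
  by apply/eqP; rewrite eq_le y1.
by move=> ->; split; rewrite ?lexx ?ler01// ltxx andbF.
Qed.

(** Almost surely the relation is a poset: a cyclic [T] then has probability [0], and an acyclic [T]
    may be replaced by its closure, whose probability is the integral defining the density of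
    [closure_poset T]. *)
Lemma pinf_contain (Pi : ppoint R) T : is_PiW mu W Pi ->
  Pr [set w | all (pinf_poset W X xi w) T] = (limit_contain Pi T)%:E.
Proof.
move=> [PiW _]; rewrite /limit_contain.
have mall U : measurable [set w | all (pinf_poset W X xi w) U].
  by apply: measurable_all => *; exact: (measurable_pinf smp).
case: ifPn => [acT|/negP nacT]; last first.
  rewrite -[RHS](measure0 Pr).
  apply: (probability_eq_negligible _ _ xi_negligible) => // w.
  move=> /contrapT/pinf_Nposet Nw.
  by split => // /(Nposet_acyclic Nw)/nacT.
rewrite (@probability_eq_negligible _ _ _ Pr _
  [set w | all (pinf_poset W X xi w) (closure_edges T)] _ _ _ xi_negligible)//.
  have uE : uniq (closure_edges T).
    apply: filter_uniq; apply: allpairs_uniq; rewrite ?iota_uniq//.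
    by move=> [? ?] [? ?].
  rewrite (prob_edges smp mW W01 uE) (PiW _ (closure_poset_fposet acT)).
  rewrite (_ : (fun x : nat -> S => _) = (fun x : nat -> S =>
      (\prod_(e <- closure_edges T) W (x e.1) (x e.2))%:E)); last first.
    apply/funext => x; congr (_%:E).
    exact: (prod_ledges_iota _ _ (fun i j => W (x i) (x j))).
  rewrite [fp_n _]size_iota (iter_int_sample smp)//.
  - apply/measurable_EFinP/measurable_prod => -[i j].
    rewrite mem_ledges !mem_iota !add0n /= => /and3P[ilt jlt _].
    apply: (measurableT_comp mW (measurable_fun_pair _ _)).
      exact: measurable_rect_fst.
    exact: measurable_rect_fst.
  - move=> x; rewrite lee_fin; apply: prodr_ge0 => e _.
    by have /andP[] := W01 (x e.1) (x e.2).
  - move=> x y xy; congr (_%:E); apply: eq_big_seq => -[i j].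
    by rewrite mem_ledges !mem_iota !add0n /= => /and3P[/xy -> /xy ->].
by move=> w /contrapT/pinf_Nposet [_ tr]; rewrite /= all_closure_edges.
Qed.

End pinf_law.

(** * A random sequence of bits with prescribed word probabilities *)

Lemma uniform_prob01E (R : realType) (A : set R) : measurable A ->
  uniform_prob (@ltr01 R) A = lebesgue_measure (A `&` `[0, 1]).
Proof.
move=> mA; rewrite /uniform_prob integral_uniform_pdf.
rewrite (eq_integral (fun=> 1%:E)); last first.
  move=> x; rewrite inE /= => -[_]; rewrite in_itv /= => x01.
  by rewrite /uniform_pdf x01 subr0 invr1.
by rewrite integral_cst ?mul1e//; apply: measurableI.
Qed.

Section bit_process.
Variable R : realType.
Variable p : seq bool -> R.
Hypothesis p1 : p [::] = 1.
Hypothesis p_ge0 : forall b, 0 <= p b.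
Hypothesis p_split : forall b, p b = p (rcons b false) + p (rcons b true).

(* The first component of [locate t n] is the length-[n] word whose interval
   contains [t], the second one the left end of that interval: the interval of
   a word [b] has length [p b] and is cut into those of [b0] and [b1]. *)
Fixpoint locate (t : R) (n : nat) : seq bool * R :=
  if n is m.+1 then
    let s := locate t m in
    let c := s.2 + p (rcons s.1 false) in
    if t < c then (rcons s.1 false, s.2) else (rcons s.1 true, c)
  else ([::], 0).

(** Induction on the last letter. The interval description is limited to [0 <= t < 1], since points
    outside also receive words; measurability and the constant left end [l] are stated for all
    [t]. *)
Lemma locate_itv b : exists l, [/\ 0 <= l, l + p b <= 1,
  measurable [set t | (locate t (size b)).1 = b],
  forall t, (locate t (size b)).1 = b -> (locate t (size b)).2 = l &
  forall t, 0 <= t < 1 -> (locate t (size b)).1 = b <-> l <= t < l + p b].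
Proof.
elim/last_ind: b => [|b c [l [l0 lp mb lE bE]]].
  exists 0; rewrite p1 add0r; split => //=.
  by rewrite (_ : [set _ | _] = setT)//; apply/seteqP; split.
have p0 := p_ge0 (rcons b false); have p1' := p_ge0 (rcons b true).
have ps := p_split b.
have step t : (locate t (size (rcons b c))).1 = rcons b c <->
    (locate t (size b)).1 = b /\ (t < l + p (rcons b false)) = ~~ c.
  rewrite size_rcons /=; split.
    case: ifPn => [lt|/negbTE ge] /= /rcons_inj[E cE].
      by rewrite -cE; move: lt; rewrite (lE _ E) E.
    by rewrite -cE; move: ge; rewrite (lE _ E) E.
  by move=> [E]; rewrite (lE _ E) E; case: ifPn => _ /=; case: c.
have mc : measurable [set t : R | (t < l + p (rcons b false)) = ~~ c].
  case: c {step} => /=.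
    rewrite (_ : [set _ | _] = `[l + p (rcons b false), +oo[%classic)//.
    apply/seteqP; split => t /=; rewrite in_itv /= andbT.
      by move/negbT; rewrite -leNgt.
    by rewrite leNgt => /negbTE.
  by rewrite -set_itvNyo; exact: measurable_itv.
exists (if c then l + p (rcons b false) else l); split.
- by case: c {step mc} => //; rewrite addr_ge0.
- by case: c {step mc}; lra.
- rewrite (_ : [set _ | _] = [set t | (locate t (size b)).1 = b] `&`
    [set t : R | (t < l + p (rcons b false)) = ~~ c]); first exact: measurableI.
  by apply/seteqP; split => t /step.
- move=> t /step[E lt]; rewrite size_rcons /= (lE _ E) E lt.
  by case: c {step mc lt}.
- move=> t t01; rewrite step (bE _ t01).
  case: c {step mc}; split.
  + by move=> [/andP[? ?] /negbT]; rewrite -leNgt => ?; apply/andP; split; lra.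
  + move=> /andP[? ?]; split; first by apply/andP; split; lra.
    by apply/negbTE; rewrite -leNgt; lra.
  + by move=> [/andP[? ?] ?]; apply/andP; split; lra.
  + by move=> /andP[? ?]; split; [apply/andP; split; lra|lra].
Qed.

Definition bit (t : R) (i : nat) : bool := last false (locate t i.+1).1.

Lemma locate_bit t n : (locate t n).1 = mkseq (bit t) n.
Proof.
elim: n => // n IH; rewrite mkseqS -IH /bit /=.
by case: ifPn => _ /=; rewrite last_rcons.
Qed.

Lemma measurable_mkseq_bit b :
  measurable [set t | mkseq (bit t) (size b) = b].
Proof.
have [l [_ _ + _ _]] := locate_itv b; congr measurable.
by apply/seteqP; split => t /=; rewrite locate_bit.
Qed.

Lemma measurable_bit i : measurable [set t | bit t i].
Proof.
rewrite (_ : [set t | _] = \bigcup_b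
  (if nth false b i && (size b == i.+1)
   then [set t | mkseq (bit t) (size b) = b] else set0)).
  apply: countable_bigcupT_measurable => [|b]; first exact: countableP.
  by case: ifP => // _; exact: measurable_mkseq_bit.
apply/seteqP; split => t /=.
  move=> ti; exists (mkseq (bit t) i.+1) => //.
  by rewrite nth_mkseq// size_mkseq eqxx ti.
move=> [b _]; case: ifP => // /andP[bi /eqP sb] /= tb.
by move: bi; rewrite -tb sb nth_mkseq.
Qed.

(** Up to the null complement of the half-open unit interval, the event is an interval of length
    [p b], possibly empty. *)
Lemma prob_bit b :
  uniform_prob (@ltr01 R) [set t | mkseq (bit t) (size b) = b] = (p b)%:E.
Proof.
have [l [l0 lp _ _ bE]] := locate_itv b.
have mI : measurable (`[l, l + p b[%classic : set (measurableTypeR R)).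
  exact: measurable_itv.
have m01 : measurable (~` `[0, 1[%classic : set (measurableTypeR R)).
  by apply: measurableC; exact: measurable_itv.
have mb : measurable ([set t | mkseq (bit t) (size b) = b] : set (measurableTypeR R)).
  exact: measurable_mkseq_bit.
pose U : probability (measurableTypeR R) R := uniform_prob (@ltr01 R).
have N0 : U.-negligible (~` `[0, 1[%classic : set (measurableTypeR R)).
  apply/negligibleP => //; rewrite [LHS]uniform_prob01E//.
  rewrite (_ : _ `&` _ = [set 1%R]) ?lebesgue_measure_set1//.
  apply/seteqP; split => y /=; rewrite !in_itv /=.
    move=> [/negP + /andP[y0 y1]]; rewrite y0 /= -leNgt => y1'.
    by apply/eqP; rewrite eq_le y1.
  by move=> ->; split; rewrite ?lexx ?ler01// ltxx andbF.
rewrite -[LHS]/(U _) (probability_eq_negligible mb mI N0).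
  rewrite [LHS]uniform_prob01E// (_ : _ `&` _ = `[l, l + p b[%classic).
    rewrite lebesgue_measure_itv/= lte_fin ltrDl.
    have := p_ge0 b; rewrite le_eqVlt => /predU1P[<-|->]; first by rewrite ltxx.
    by rewrite -EFinD addrAC subrr add0r.
  apply/seteqP; split => t /=; rewrite !in_itv /=; first by case.
  by move=> /andP[lt tl]; split; apply/andP; split => //; lra.
move=> t /contrapT /=; rewrite in_itv /= => /bE; rewrite locate_bit in_itv /=.
by [].
Qed.

End bit_process.

(** * Existence of the limit law *)

Section probability_integral.
Context (R : realType) (d : measure_display) (O : measurableType d)
  (Pr : probability O R).

Lemma probability_integrable (f : O -> R) M :
  measurable_fun setT f -> (forall w, `|f w| <= M) ->
  Pr.-integrable setT (EFin \o f).
Proof.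
move=> mf fM; apply: measurable_bounded_integrable => //.
  by rewrite -ge0_fin_numE// fin_num_measure.
exists M; split; rewrite ?num_real// => x Mx w _ /=.
exact: le_trans (fM w) (ltW Mx).
Qed.

Lemma Rintegral_prob (b : O -> bool) : measurable [set w | b w] ->
  \int[Pr]_w ((b w)%:R : R) = fine (Pr [set w | b w]).
Proof.
move=> mb; rewrite /Rintegral; congr fine.
rewrite -[X in _ = Pr X]setIT -integral_indic//; apply: eq_integral => w _.
rewrite indicE; congr (_%:R%:E); congr nat_of_bool.
by apply/idP/idP; rewrite inE.
Qed.

Lemma Rintegral_dist (f g : O -> R) eps :
  Pr.-integrable setT (EFin \o f) -> Pr.-integrable setT (EFin \o g) ->
  (forall w, `|f w - g w| <= eps) ->
  `|\int[Pr]_w f w - \int[Pr]_w g w| <= eps.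
Proof.
move=> fi gi fg.
have fgi : Pr.-integrable setT (EFin \o (fun w => f w - g w)).
  by have := integrableB measurableT fi gi; apply: eq_integrable.
rewrite -RintegralB//; apply: le_trans (le_normr_Rintegral _ fgi) _ => //.
have -> : eps = \int[Pr]_w eps.
  by rewrite Rintegral_cst// [X in _ * fine X](probability_setT Pr) mulr1.
apply: le_Rintegral => //.
- exact: (integrable_norm fgi).
- by apply: (@probability_integrable _ `|eps|) => //; exact: measurable_cst.
Qed.

End probability_integral.

Lemma card_labellings n : #|{perm 'I_n}| = n`!.
Proof. by rewrite -card_Sn; apply: eq_card => s; rewrite !inE. Qed.

Lemma hat_expect_cst (R : realType) P (c : R) : hat_expect P (fun=> c) = c.
Proof.
by rewrite /hat_expect sumr_const card_labellings -[c *+ _]mulr_natr mulfK.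
Qed.

Lemma hat_expect_dist (R : realType) P (f g : cube -> R) eps :
  (forall x, `|f x - g x| <= eps) ->
  `|hat_expect P f - hat_expect P g| <= eps.
Proof.
move=> fg; rewrite /hat_expect -mulrBl -sumrB normrM.
rewrite [X in _ * X]ger0_norm ?invr_ge0 ?ler0n//.
rewrite ler_pdivrMr ?ltr0n ?fact_gt0//; apply: le_trans (ler_norm_sum _ _ _) _.
apply: le_trans (ler_sum _ (fun s _ => fg (hat_rel s))) _.
by rewrite sumr_const card_labellings mulr_natr.
Qed.

(** * Convergence in distribution from prefix probabilities *)

Section prefixes.
Variables (enc : nat * nat -> nat) (dec : nat -> nat * nat).
Hypothesis encK : cancel enc dec.
Hypothesis decK : cancel dec enc.

Definition prefix_is (b : seq bool) (x : cube) : bool :=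
  mkseq (fun i => x (dec i)) (size b) == b.

Lemma prefix_is_rcons b c x :
  prefix_is (rcons b c) x = prefix_is b x && (x (dec (size b)) == c).
Proof. by rewrite /prefix_is size_rcons mkseqS eqseq_rcons. Qed.

Lemma prefix_is_split b x : (prefix_is b x = prefix_is (rcons b false) x
  + prefix_is (rcons b true) x :> nat)%N.
Proof.
by rewrite !prefix_is_rcons; case: (prefix_is b x); case: (x _).
Qed.

Lemma prefix_is_local b (x y : cube) :
  (forall e, e \in [seq dec i | i <- iota 0 (size b)] -> x e = y e) ->
  prefix_is b x = prefix_is b y.
Proof.
move=> xy; congr (_ == _); apply/eq_in_map => i ib; apply: xy.
by apply/mapP; exists i.
Qed.

Section convergence.
Context (R : realType) (u : nat -> fposet) (d : measure_display)
  (O : measurableType d) (Pr : probability O R) (X : O -> cube).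
Hypothesis mX : forall ij, measurable [set w | X w ij].
Hypothesis cvg_prefix : forall b,
  (fun n => hat_expect (u n) (fun x => (prefix_is b x)%:R) : R) @ \oo -->
  fine (Pr [set w | prefix_is b (X w)]).

Lemma measurable_prefix b : measurable [set w | prefix_is b (X w)].
Proof.
elim/last_ind: b => [|b c IH]; first by rewrite set_true.
under eq_set do rewrite prefix_is_rcons.
rewrite (_ : [set w | _] = [set w | prefix_is b (X w)] `&`
   [set w | all (fun e => X w e == c) [:: dec (size b)]]).
  by apply: measurableI => //; exact: (measurable_agree (fun=> c)).
by apply/seteqP; split => w /=; rewrite andbT => /andP.
Qed.

(** Here [k] counts the coordinates of [g] not yet fixed by the word [b]. For [k = 0] the function
    is constant on the prefix event; otherwise that event is split along the next coordinate. *)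
Lemma prefix_local k b (g : cube -> R) :
  (forall x y : cube, (forall i, (i < size b + k)%N -> x (dec i) = y (dec i)) ->
    g x = g y) ->
  [/\ measurable_fun setT (fun w => (prefix_is b (X w))%:R * g (X w)),
      exists M, forall x, `|(prefix_is b x)%:R * g x| <= M &
      (fun n => hat_expect (u n) (fun x => (prefix_is b x)%:R * g x))
        @ \oo --> \int[Pr]_w ((prefix_is b (X w))%:R * g (X w))].
Proof.
elim: k b g => [|k IH] b g gb.
  (* A point with prefix [b]; the padding by [false] does not affect [g], which depends only on the
     first [size b] coordinates. *)
  pose xb : cube := fun e => nth false b (enc e).
  have gE x : (prefix_is b x)%:R * g x = g xb * (prefix_is b x)%:R.
    case: (boolP (prefix_is b x)) => [|_]; last by rewrite mul0r mulr0.
    move=> /eqP xE; rewrite mulrC; congr (_ * _).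
    apply: gb => i; rewrite addn0 => ib.
    by rewrite /xb decK -xE nth_mkseq.
  have mp := measurable_prefix b.
  have mp' : measurable_fun setT (fun w => (prefix_is b (X w))%:R : R).
    exact: measurable_fun_nat_of_bool.
  split.
  - by under eq_fun do rewrite gE; exact: measurable_funM.
  - exists `|g xb| => x; rewrite gE normrM ler_piMr//.
    by case: (prefix_is b x); rewrite ?normr1 ?normr0.
  - under [X in _ --> X]eq_Rintegral do rewrite gE.
    rewrite RintegralZl//; last first.
      apply: (@probability_integrable _ _ _ _ _ 1) => // w.
      by case: (prefix_is b _); rewrite ?normr1 ?normr0.
    rewrite Rintegral_prob//.
    have : (fun n => g xb * hat_expect (u n) (fun x => (prefix_is b x)%:R)) @ \oo
      --> g xb * fine (Pr [set w | prefix_is b (X w)]) by exact: cvgMr.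
    apply: cvg_trans; apply: near_eq_cvg; apply: nearW => n.
    by rewrite -hat_expectZ; congr hat_expect; apply/funext => x; rewrite gE.
have gS c : forall x y : cube,
   (forall i, (i < size (rcons b c) + k)%N -> x (dec i) = y (dec i)) -> g x = g y.
  by rewrite size_rcons addSnnS.
have [m0 [M0 b0] c0] := IH _ _ (gS false).
have [m1 [M1 b1] c1] := IH _ _ (gS true).
have gE x : (prefix_is b x)%:R * g x =
    (prefix_is (rcons b false) x)%:R * g x + (prefix_is (rcons b true) x)%:R * g x.
  by rewrite prefix_is_split natrD mulrDl.
split.
- by under eq_fun do rewrite gE; exact: measurable_funD.
- exists (M0 + M1) => x; rewrite gE.
  by apply: le_trans (ler_normD _ _) _; exact: lerD.
- under [X in _ --> X]eq_Rintegral do rewrite gE.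
  rewrite RintegralD//; last 2 first.
  + by apply: (@probability_integrable _ _ _ _ _ M0) => // w; exact: b0.
  + by apply: (@probability_integrable _ _ _ _ _ M1) => // w; exact: b1.
  pose h c n := hat_expect (u n) (fun x => (prefix_is (rcons b c) x)%:R * g x).
  have : (fun n => h false n + h true n) @ \oo -->
    \int[Pr]_w ((prefix_is (rcons b false) (X w))%:R * g (X w)) +
    \int[Pr]_w ((prefix_is (rcons b true) (X w))%:R * g (X w)) by exact: cvgD.
  apply: cvg_trans; apply: near_eq_cvg; apply: nearW => n.
  by rewrite -hat_expectD; congr hat_expect; apply/funext => x; rewrite gE.
Qed.

(** [fN N] evaluates [f] after erasing all coordinates from [N] on. It is uniformly close to [f] and
    converges by [prefix_local], so an [eps / 3] argument concludes. *)
Lemma cvg_dist_prefix : cvg_dist u Pr X.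
Proof.
move=> f fc [M fM].
pose fN N (x : cube) : R := f (fun e => if (enc e < N)%N then x e else false).
have loc N (x y : cube) :
    (forall i, (i < size (@nil bool) + N)%N -> x (dec i) = y (dec i)) ->
    fN N x = fN N y.
  move=> xy; congr f; apply/funext => e; case: ifP => // eN.
  by rewrite -(encK e) xy.
have approx eps : 0 < eps -> exists N0, forall N x, (N0 <= N)%N ->
    `|f x - fN N x| < eps.
  move=> e0; have [N0 HN0] := continuous_cylinder_approx enc fc e0.
  exists N0 => N x N0N; apply: HN0 => e eN0.
  by rewrite (leq_trans eN0 N0N).
have mfN N : measurable_fun setT (fun w => fN N (X w)).
  have [+ _ _] := @prefix_local N [::] (fN N) (loc N).
  by under eq_fun do rewrite mul1r.
have cfN N : (fun n => hat_expect (u n) (fN N)) @ \oo --> \int[Pr]_w fN N (X w).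
  have [_ _] := @prefix_local N [::] (fN N) (loc N).
  under [X in _ --> X]eq_Rintegral do rewrite mul1r.
  by under eq_fun do under eq_fun do rewrite mul1r.
(* Measurability of [f] along [X] comes from the pointwise limit of the truncations. *)
have mf : measurable_fun setT (fun w => f (X w)).
  apply: (@measurable_fun_cvg _ _ _ _ (fun N w => fN N (X w))) => // w _.
  apply/cvgrPdist_lt => eps e0; have [N0 HN0] := approx _ e0.
  by exists N0 => // N /= N0N; exact: HN0.
have fi : Pr.-integrable setT (EFin \o (fun w => f (X w))).
  by apply: (@probability_integrable _ _ _ _ _ M).
have fNi N : Pr.-integrable setT (EFin \o (fun w => fN N (X w))).
  by apply: (@probability_integrable _ _ _ _ _ M) => // w; exact: fM.
rewrite -[X in _ --> X]fineK; last exact: (integrable_fin_num measurableT fi).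
apply: cvg_EFin; first exact: nearW.
apply/cvgrPdist_lt => eps e0.
have e3 : 0 < eps / 3 by rewrite divr_gt0.
have [N HN] := approx _ e3.
have /cvgrPdist_lt/(_ _ e3) := cfN N; apply: filterS => n /= cn.
have h1 : `|\int[Pr]_w f (X w) - \int[Pr]_w fN N (X w)| <= eps / 3.
  by apply: Rintegral_dist => // w; apply/ltW/HN.
have h2 : `|hat_expect (u n) f - hat_expect (u n) (fN N)| <= eps / 3.
  by apply: hat_expect_dist => x; apply/ltW/HN.
rewrite -/(Rintegral Pr setT (fun w => f (X w))).
move: h1 h2 cn; set a := Rintegral _ _ _; set b := Rintegral _ _ _.
set c := hat_expect _ f; set e := hat_expect _ _.
rewrite !ler_norml !ltr_norml => /andP[? ?] /andP[? ?] /andP[? ?].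
by apply/andP; split; lra.
Qed.

End convergence.
End prefixes.

Lemma nat_pair_bij : exists (enc : nat * nat -> nat) (dec : nat -> nat * nat),
  cancel enc dec /\ cancel dec enc.
Proof.
have /card_set_bijP[enc [_ inj surj]] := card_nat2.
have [n|dec decK] := @choice _ _ (fun n e => enc e = n).
  by have [e _ <-] := surj n I; exists e.
exists enc, dec; split => // e; apply: inj; rewrite ?inE//.
Qed.

Lemma limit_law_exists (R : realType) (u : nat -> fposet) (Pi : ppoint R) :
  (forall n, is_fposet (u n)) -> fp_cvg u Pi -> Pi.2 = 0 ->
  exists (d : measure_display) (Omega : measurableType d)
    (Pr : probability Omega R) (X : Omega -> cube),
    random_Nposet X /\ cvg_dist u Pr X.
Proof.
move=> up uPi Pi0; have [enc [dec [encK decK]]] := nat_pair_bij.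
(* [p b] is the limiting probability of the prefix [b]. It inherits total mass, nonnegativity and
   the splitting rule from the finite labellings, as the bit process requires. *)
have [b|p pP] := @choice _ _ (fun b (l : R) => (fun n =>
    hat_expect (u n) (fun x => (prefix_is dec b x)%:R) : R) @ \oo --> l).
  have [l Hl] := @cvg_local R Pi [seq dec i | i <- iota 0 (size b)]
    (fun x => (prefix_is dec b x)%:R) Pi0
    (fun x y xy => congr1 (fun c : bool => c%:R) (prefix_is_local xy)).
  by exists l; exact: Hl.
have p1 : p [::] = 1.
  apply: (cvg_unique _ (pP [::])) => //.
  rewrite (_ : (fun n => _) = fun=> 1); first exact: cvg_cst.
  by apply/funext => n; exact: hat_expect_cst.
have p_ge0 b : 0 <= p b.
  rewrite -(cvg_lim _ (pP b))//; apply: limr_ge; first by apply/cvg_ex; exists (p b).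
  by apply: nearW => n; rewrite divr_ge0 ?ler0n// sumr_ge0.
have p_split b : p b = p (rcons b false) + p (rcons b true).
  apply: (cvg_unique _ (pP b)) => //.
  pose h c n : R := hat_expect (u n) (fun x => (prefix_is dec (rcons b c) x)%:R).
  have : (fun n => h false n + h true n) @ \oo -->
    p (rcons b false) + p (rcons b true) by apply: cvgD; exact: pP.
  apply: cvg_trans; apply: near_eq_cvg; apply: nearW => n.
  rewrite -hat_expectD; congr hat_expect; apply/funext => x.
  by rewrite [in RHS]prefix_is_split natrD.
pose U : probability (measurableTypeR R) R := uniform_prob (@ltr01 R).
pose X0 (t : measurableTypeR R) : cube := fun e => bit p t (enc e).
have mX0 e : measurable [set t | X0 t e] by exact: measurable_bit.
have X0E b t : prefix_is dec b (X0 t) = (mkseq (bit p t) (size b) == b).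
  by congr (_ == _); apply: eq_mkseq => i; rewrite /X0 decK.
have UX0 b : U [set t | prefix_is dec b (X0 t)] = (p b)%:E.
  rewrite -(prob_bit p1 p_ge0 p_split b); congr (U _).
  by apply/seteqP; split => t /=; rewrite X0E => /eqP.
have cX0 b : (fun n => hat_expect (u n) (fun x => (prefix_is dec b x)%:R) : R)
    @ \oo --> fine (U [set t | prefix_is dec b (X0 t)]) by rewrite UX0; exact: pP.
(* [viol v] is a failure of irreflexivity or transitivity at one triple. It depends on finitely many
   coordinates and never occurs in a labelled finite poset, so its probability vanishes in the
   limit; there are countably many triples. *)
pose viol (v : nat * nat * nat) (x : cube) := x (v.1.1, v.1.1) ||
  [&& x (v.1.1, v.1.2), x (v.1.2, v.2) & ~~ x (v.1.1, v.2)].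
have NposetP x : is_Nposet x <-> forall v, ~~ viol v x.
  split => [[irr tr] [[i j] k]|H].
    rewrite negb_or (irr i) /=; apply/negP => /and3P[ij jk].
    by rewrite (tr _ _ _ ij jk).
  split => [i|i j k ij jk].
    by have := H (i, i, i); rewrite negb_or => /andP[].
  have := H (i, j, k); rewrite negb_or => /andP[_].
  by rewrite /= ij jk /= negbK.
have mviol v : measurable [set t | viol v (X0 t)].
  rewrite (_ : [set t | _] = [set t | X0 t (v.1.1, v.1.1)] `|`
    ([set t | X0 t (v.1.1, v.1.2)] `&` ([set t | X0 t (v.1.2, v.2)] `&`
     ~` [set t | X0 t (v.1.1, v.2)]))).
    apply: measurableU => //; apply: measurableI => //; apply: measurableI => //.
    exact: measurableC.
  apply/seteqP; split => t /=.
    by move=> /orP[?|/and3P[? ? /negP ?]]; [left|right].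
  by move=> [xii|[xij [xjk /negP xik]]]; apply/orP; [left|right; apply/and3P].
have viol0 v : U [set t | viol v (X0 t)] = 0%E.
  rewrite -[LHS]fineK ?fin_num_measure//; congr (_%:E).
  have := @cvg_dist_prob _ _ _ _ _ _ [:: (v.1.1, v.1.1); (v.1.1, v.1.2);
    (v.1.2, v.2); (v.1.1, v.2)] (viol v) (cvg_dist_prefix encK decK mX0 cX0).
  move=> /(_ _ (mviol v)) H; apply: (cvg_unique _ (H _)) => //.
    move=> x y xy; rewrite /viol !xy ?inE ?eqxx ?orbT//.
  rewrite (_ : (fun n => _) = fun=> 0); first exact: cvg_cst.
  apply/funext => n; rewrite (eq_hat_expect (g := fun=> 0))//.
    exact: hat_expect_cst.
  by move=> x /NposetP/(_ v)/negbTE ->.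
have N0 : U.-negligible [set t | ~ is_Nposet (X0 t)].
  pose dv n : nat * nat * nat := odflt (0, 0, 0)%N (unpickle n).
  apply: (@negligibleS _ _ _ _ (\bigcup_n [set t | viol (dv n) (X0 t)])).
    move=> t /= nt; apply: contrapT => H; apply: nt; apply/NposetP => v.
    apply/negP => tv; apply: H; exists (pickle v) => //=.
    by rewrite /dv pickleK.
  by apply: negligible_bigcup => n; apply/negligibleP => //; exact: viol0.
have mN : measurable [set t | is_Nposet (X0 t)].
  rewrite (_ : [set t | _] = ~` \bigcup_v [set t | viol v (X0 t)]).
    apply/measurableC/countable_bigcupT_measurable => //; exact: countableP.
  apply/seteqP; split => t /=.
    by move=> /NposetP H [v _ /=]; apply/negP.
  by move=> H; apply/NposetP => v; apply/negP => vt; apply: H; exists v.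
(* Every outcome must be a poset, so the exceptional null set is sent to the empty order. *)
pose X (t : measurableTypeR R) : cube :=
  if `[< is_Nposet (X0 t) >] then X0 t else xpred0.
have XE t : is_Nposet (X0 t) -> X t = X0 t by move=> H; rewrite /X asboolT.
have mX e : measurable [set t | X t e].
  rewrite (_ : [set t | _] = [set t | is_Nposet (X0 t)] `&` [set t | X0 t e]).
    exact: measurableI.
  apply/seteqP; split => t /=.
    by rewrite /X; case: asboolP.
  by move=> [/XE ->].
exists _, (measurableTypeR R), U, X; split.
  by split=> [t|//]; rewrite /X; case: asboolP.
apply: (cvg_dist_prefix encK decK mX) => b.
rewrite (_ : U _ = U [set t | prefix_is dec b (X0 t)])//.
apply: (probability_eq_negligible _ _ N0).
- exact: measurable_prefix.
- exact: measurable_prefix.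
- by move=> t /contrapT /XE E; rewrite /= E.
Qed.

(** * Characterization of the limit *)

Lemma fposet_eq n m (r : rel 'I_n) (r' : rel 'I_m) : n = m ->
  (forall (i j : 'I_n) (i' j' : 'I_m), i = i' :> nat -> j = j' :> nat ->
     r i j = r' i' j') ->
  FPoset r = FPoset r'.
Proof.
move=> nm; case: m / nm r' => r' rr'; congr FPoset.
by apply/funext => i; apply/funext => j; exact: rr'.
Qed.

(** Labelling by [0, ..., n - 1] carries convergence statements about labelled posets over to every
    coordinate [Q]. *)
Lemma lposet_code_iota (Q : fposet) :
  exists q, lposet_code (iota 0 (fp_n Q)) q = Q.
Proof.
case: Q => n r; exists (fun x y => if insub x is Some i then
  if insub y is Some j then r i j else false else false).
apply: fposet_eq => [|i j i' j' ii' jj']; first by rewrite size_iota.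
have lt (k : 'I_(size (iota 0 n))) : (k < n)%N.
  by have := ltn_ord k; rewrite [X in (_ < X)%N -> _]size_iota.
by rewrite !nth_iota// !add0n ii' jj' !valK.
Qed.

Lemma fp_cvg_in_closure (R : realType) (u : nat -> fposet) (Pi : ppoint R) :
  (forall n, is_fposet (u n)) -> fp_cvg u Pi -> in_closure Pi.
Proof.
move=> up [uPi u2] Qs eps e0 Qsp.
have H : \forall n \near \oo, forall Q, List.In Q Qs ->
    `|tdens R Q (u n) - Pi.1 Q| < eps.
  elim: Qs Qsp => [|Q Qs IH] Qsp; first exact: nearW.
  have HQ : \forall n \near \oo, `|tdens R Q (u n) - Pi.1 Q| < eps.
    have /cvgrPdist_lt/(_ _ e0) := uPi Q (Qsp Q (or_introl erefl)).
    by apply: filterS => n; rewrite distrC.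
  have {}IH := IH (fun Q' H => Qsp Q' (or_intror H)).
  by apply: filterS2 HQ IH => n HQ IH Q' [<-//|]; exact: IH.
have /cvgrPdist_lt/(_ _ e0) H2 := u2.
have [n [H1n H2n]] := filter_ex (filterI H H2).
by exists (u n); split => //; split => //; rewrite distrC.
Qed.

Lemma all_ledges (x : cube) A q : all x (ledges A q) <->
  (forall i j, i \in A -> j \in A -> q i j -> x (i, j)).
Proof.
split=> [/allP H i j iA jA qij|H]; first by apply: H; rewrite mem_ledges iA jA.
by apply/allP => -[i j]; rewrite mem_ledges => /and3P[]; exact: H.
Qed.

Lemma all_agree_pairs (x : cube) A q :
  all (fun e => x e == q e.1 e.2) [seq (i, j) | i <- A, j <- A] <->
  (forall i j, i \in A -> j \in A -> x (i, j) = q i j).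
Proof.
split=> [/allP H i j iA jA|H].
  by apply/eqP; apply: (H (i, j)); apply/allpairsP; exists (i, j).
by apply/allP => _ /allpairsP[[i j] /= [iA jA ->]] /=; rewrite H.
Qed.

Section limit_poset.
Context (R : realType) (u : nat -> fposet) (d : measure_display)
  (O : measurableType d) (Pr : probability O R) (X : O -> cube).
Hypothesis up : forall n, is_fposet (u n).
Hypothesis u0 : (fun n => (fp_n (u n))%:R^-1 : R) @ \oo --> (0 : R).
Hypothesis rX : random_Nposet X.
Hypothesis uX : cvg_dist u Pr X.

Let mX : forall ij, measurable [set w | X w ij]. Proof. by case: rX. Qed.

Let finePr T : (fine (Pr [set w | all (X w) T]))%:E = Pr [set w | all (X w) T].
Proof. by rewrite fineK// fin_num_measure//; apply: measurable_all. Qed.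

Lemma cvg_tdens_contain A q : uniq A ->
  (fun n => tdens R (lposet_code A q) (u n)) @ \oo -->
  fine (Pr [set w | all (X w) (ledges A q)]).
Proof. by move=> uA; apply/(cvg_hat_hom up u0 _ _ uA)/cvg_dist_contain. Qed.

Lemma fp_cvg_limit : fp_cvg u
  (fun Q => lim ((fun n => tdens R Q (u n)) @ \oo), 0 : R).
Proof.
split => //= Q _; have [q <-] := lposet_code_iota Q.
have := @cvg_tdens_contain _ q (iota_uniq 0 (fp_n Q)).
by move=> H; apply/cvg_ex; eexists; exact: H.
Qed.

(** Containing [S] after relabelling by [pi] means containing the image of [S] under [pi]. Both
    relations have the same unlabelled code, so their probabilities are limits of the same
    densities. *)
Lemma exchangeable_limit : exchangeable Pr X.
Proof.
move=> pi [rho piK rhoK]; apply: same_law_contain => // S.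
pose A := iota 0 (label_bound S).
(* [q'] is [q] transported along [pi], written with the inverse [rho]. *)
pose q x y := (x, y) \in S; pose q' x y := (rho x, rho y) \in S.
have uA : uniq A by exact: iota_uniq.
have uA' : uniq (map pi A) by rewrite map_inj_uniq//; exact: can_inj piK.
have qE : lposet_code (map pi A) q' = lposet_code A q.
  apply: fposet_eq => [|i j i' j' ii' jj']; first by rewrite size_map.
  by rewrite ii' jj' /q' !(nth_map 0) ?ltn_ord// !piK.
have := @cvg_tdens_contain _ q' uA'; rewrite qE => H.
have AE (x : cube) : all x (ledges A q) = all x S.
  apply/idP/idP => [/all_ledges H'|/allP H'].
    apply/allP => -[i j] ijS; have [/= ib jb] := ltn_label_bound ijS.
    by apply: H'; rewrite ?mem_iota.
  by apply/all_ledges => i j _ _; exact: H'.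
have AE' (x : cube) : all x (ledges (map pi A) q') =
    all (fun ij => x (pi ij.1, pi ij.2)) S.
  rewrite -AE; apply/idP/idP => [/all_ledges H'|/all_ledges H'].
    apply/all_ledges => i j iA jA qij; apply: H'; rewrite ?map_f//.
    by rewrite /q' !piK.
  apply/all_ledges => _ _ /mapP[i iA ->] /mapP[j jA ->]; rewrite /q' !piK.
  exact: (H' i j).
have E := cvg_unique (@norm_hausdorff _ _) H (@cvg_tdens_contain _ q uA).
under eq_set do rewrite -AE'; under [in RHS]eq_set do rewrite -AE.
by rewrite -[LHS]finePr -[RHS]finePr E.
Qed.

Variable Pi : ppoint R.
Hypothesis uPi : fp_cvg u Pi.

Let Pi0 : Pi.2 = 0.
Proof. exact: (cvg_unique (@norm_hausdorff _ _) uPi.2 u0). Qed.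

(** Both laws give containment of [T] the probability [limit_contain Pi T]: one as a limit along
    [u], the other by integration. *)
Lemma law_Pinf_limit : law_Pinf Pr X Pi.
Proof.
move=> d' S mu prec W oprec kW PiW d2 O' P' Y xi smp.
apply: same_law_contain => //.
  by move=> ij; apply: (measurable_pinf smp); case: kW.
move=> T; rewrite (pinf_contain smp oprec kW T PiW) -finePr; congr (_%:E).
exact: (cvg_unique (@norm_hausdorff _ _) (@cvg_dist_contain _ _ _ _ _ _ T uX mX)
  (cvg_contain up uPi Pi0)).
Qed.

Lemma tdens_limit A q : is_lposet A q -> ((Pi.1 (lposet_code A q))%:E =
  Pr [set w | forall x y, x \in A -> y \in A -> q x y -> X w (x, y)])%E.
Proof.
move=> Aq; have [uA _] := Aq.
rewrite (_ : [set w | _] = [set w | all (X w) (ledges A q)]); last first.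
  by apply/seteqP; split => w /all_ledges.
rewrite -finePr; congr (_%:E).
exact: (cvg_unique (@norm_hausdorff _ _) (uPi.1 _ (lposet_code_fposet Aq))
  (@cvg_tdens_contain _ q uA)).
Qed.

(** The extension is tested on every sequence [v] converging to [Pi]. By [cvg_local] the limit is
    the same for all of them, and along [u] it is the stated probability. *)
Lemma tind_limit A q : is_lposet A q -> tind_ext (lposet_code A q) Pi
  (fine (Pr [set w | forall x y, x \in A -> y \in A -> X w (x, y) = q x y])).
Proof.
move=> [uA _] v vp vPi.
pose L := [seq (i, j) | i <- A, j <- A].
rewrite (_ : [set w | _] = [set w | all (fun e => X w e == q e.1 e.2) L]); last first.
  by apply/seteqP; split => w /all_agree_pairs.
have [l Hl] := @cvg_local R Pi L (fun x => (all (fun e => x e == q e.1 e.2) L)%:R) Pi0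
  (fun x y xy => congr1 (fun c : bool => c%:R)
    (eq_in_all (fun e eL => congr1 (eq_op^~ _) (xy e eL)))).
rewrite (cvg_unique (@norm_hausdorff _ _)
  (@cvg_dist_agree _ _ _ _ _ _ (fun e => q e.1 e.2) L uX mX) (Hl u up uPi)).
have v0 := vPi.2; rewrite Pi0 in v0.
apply: cvg_trans (Hl v vp vPi); apply: near_eq_cvg.
by have := near_hat_ind vp v0 q uA; apply: filterS => n ->.
Qed.

End limit_poset.

Theorem theorem1p17 (R : realType) (P : nat -> fposet) :
  (forall n, is_fposet (P n)) ->
  ((fun n => (fp_n (P n))%:R : R) @ \oo --> +oo) ->
  ((exists Pi : ppoint R, in_closure Pi /\ fp_cvg P Pi) <->
   (exists (d : measure_display) (Omega : measurableType d)
      (Pr : probability Omega R) (X : Omega -> cube),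
      random_Nposet X /\ cvg_dist P Pr X)) /\
  (forall Pi : ppoint R, in_closure Pi -> fp_cvg P Pi ->
   forall (d : measure_display) (Omega : measurableType d)
      (Pr : probability Omega R) (X : Omega -> cube),
     random_Nposet X -> cvg_dist P Pr X ->
     exchangeable Pr X /\ law_Pinf Pr X Pi /\
     (forall (A : seq nat) (q : rel nat), is_lposet A q ->
        ((Pi.1 (lposet_code A q))%:E =
           Pr [set w | forall x y, x \in A -> y \in A -> q x y -> X w (x, y)])%E /\
        tind_ext (lposet_code A q) Pi
          (fine (Pr [set w | forall x y, x \in A -> y \in A ->
                               X w (x, y) = q x y])))).
Proof.
move=> Pp Pinf.
have P0 : (fun n => (fp_n (P n))%:R^-1 : R) @ \oo --> (0 : R).
  apply/gtr0_cvgV0 => //; apply: nearW => n; rewrite ltr0n.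
  by have [] := Pp n.
split; first split.
- move=> [Pi [_ PPi]]; apply: (limit_law_exists Pp PPi).
  exact: (cvg_unique (@norm_hausdorff _ _) PPi.2 P0).
- move=> [d [T [Pr [X [rX PX]]]]].
  (* The limit point has the limits of the densities as coordinates and [0] as inverse size. *)
  have PPi := fp_cvg_limit Pp P0 rX PX.
  by eexists; split; [exact: (fp_cvg_in_closure Pp PPi)|exact: PPi].
- move=> Pi _ PPi d T Pr X rX PX; split; first exact: (exchangeable_limit Pp P0 rX PX).
  split; first exact: (law_Pinf_limit Pp P0 rX PX PPi).
  by move=> A q Aq; split; [exact: (tdens_limit Pp P0 rX PX PPi Aq)|
    exact: (tind_limit Pp P0 rX PX PPi Aq)].
Qed.
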